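(* Let $U:\mathcal C\to\mathcal D$ be a pseudofunctor between 2-categories. For each object $A\in\mathcal D$ let $FA$ be an object of $\mathcal C$ and $y_A:A\to UFA$ a 1-cell of $\mathcal D$, and suppose that the collection $(y_A)_{A\in\mathcal D}$ is coherently closed for $U$-extensions, with chosen $U$-extensions $(f^{\mathbb D},\mathbb D_f)$. Then: (1) the mapping $A\mapsto FA$ can be extended to a colax functor $F:\mathcal D\to\mathcal C$; (2) $y$ can be extended to a colax natural transformation $1_{\mathcal D}\Rightarrow UF$; (3) there exist a colax natural transformation $\epsilon:FU\Rightarrow 1_{\mathcal C}$ and a modification $\Phi:1_U\to U\epsilon\circ yU$. Assume moreover that the unit and composition axioms for $U$-extensions hold. Then, for the colax functor $F:\mathcal D\to\mathcal C$, the colax natural transformations $y:1_{\mathcal D}\Rightarrow UF$ and $\epsilon:FU\Rightarrow 1_{\mathcal C}$ and the modification $\Phi:1_U\to U\epsilon\circ yU$ given by $Ff=(y_Bf)^{\mathbb D}$ and $y_f=\mathbb D_{y_Bf}$ for $f:A\to B$ in $\mathcal D$, and $\epsilon_B=1_{UB}^{\mathbb D}$ and $\Phi_B=\mathbb D_{1_{UB}}$ for $B\in\mathcal C$ (the action of $F$ on 2-cells, its structure 2-cells and the 2-cells $\epsilon_h$ being the unique ones, induced by the universal property of $U$-extensions, for which $y$ is colax natural and $\Phi$ is a modification): (4) $F$ is a pseudofunctor; (5) there is an invertible modification $\Psi:\epsilon F\circ Fy\to 1_F$, and all these data give a colax adjunction $(\Psi,\Phi):(\epsilon,y)$ in which $F:\mathcal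 D\to\mathcal C$ is left colax adjoint to $U:\mathcal C\to\mathcal D$.
   Context: Conventions. For a colax functor $H$ between 2-categories the structure 2-cells are $\gamma:H(gf)\Rightarrow Hg\circ Hf$ and $\iota:H1_A\Rightarrow 1_{HA}$ (with the usual naturality, associativity and unit axioms); a pseudofunctor is a colax functor with $\gamma,\iota$ invertible. A colax natural transformation $\alpha:H\Rightarrow G$ between colax functors consists of 1-cells $\alpha_A:HA\to GA$ and 2-cells $\alpha_f:\alpha_B\circ Hf\Rightarrow Gf\circ\alpha_A$ for $f:A\to B$, subject to the usual unit, composition and local naturality axioms. A modification $\Gamma:\alpha\to\beta$ is a family of 2-cells $\Gamma_A:\alpha_A\Rightarrow\beta_A$ with $(Gf\,\Gamma_A)\circ\alpha_f=\beta_f\circ(\Gamma_B\,Hf)$. For a pseudofunctor $K$, the colax natural transformation $K\alpha$ has 1-cell components $K\alpha_A$ and 2-cell components $\gamma\circ K(\alpha_f)\circ\gamma^{-1}$. Colax adjunction. A colax adjunction $(\Psi,\Phi):(\epsilon,\eta)$ exhibiting $F:\mathcal X\to\mathcal Y$ as left colax adjoint to $U:\mathcal Y\to\mathcal X$ consists of pseudofunctors $F,U$, colax natural transformations $\eta:1_{\mathcal X}\Rightarrow UF$, $\epsilon:FU\Rightarrow 1_{\mathcal Y}$ and modifications $\Psi:\epsilon F\circ F\eta\to 1_F$, $\Phi:1_U\to U\epsilon\circ\eta U$ such that for all $A\in\mathcal X$, $B\in\mathcal Y$ the following composites are identities (swallowtail identities): $$\eta_A\xrightarrow{\Phi_{FA}\eta_A}U\epsilon_{FA}\,\eta_{UFA}\,\eta_A\xrightarrow{U\epsilon_{FA}\,\eta_{\eta_A}}U\epsilon_{FA}\,UF\eta_A\,\eta_A\xrightarrow{(U\Psi)_A\eta_A}\eta_A,$$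 $$\epsilon_B\xrightarrow{\epsilon_B(F\Phi)_B}\epsilon_B\,FU\epsilon_B\,F\eta_{UB}\xrightarrow{\epsilon_{\epsilon_B}F\eta_{UB}}\epsilon_B\,\epsilon_{FUB}\,F\eta_{UB}\xrightarrow{\epsilon_B\Psi_{UB}}\epsilon_B,$$ where $(U\Psi)_A=\iota\circ U\Psi_A\circ\gamma^{-1}$ and $(F\Phi)_B=\gamma\circ F\Phi_B\circ\iota^{-1}$. $U$-extensions. Let $U:\mathcal C\to\mathcal D$ be a pseudofunctor, $y_A:A\to UFA$ and $f:A\to UB$ 1-cells of $\mathcal D$ (with $FA,B\in\mathcal C$). A left $U$-extension (or just $U$-extension) of $f$ along $y_A$ is a pair $(f',\psi_f)$ of a 1-cell $f':FA\to B$ of $\mathcal C$ and a 2-cell $\psi_f:f\Rightarrow Uf'\circ y_A$ such that for every pair $(g:FA\to B,\ \alpha:f\Rightarrow Ug\circ y_A)$ there is a unique 2-cell $\theta:f'\Rightarrow g$ with $(U\theta\,y_A)\circ\psi_f=\alpha$. The collection $(y_A:A\to UFA)_{A\in\mathcal D}$ is coherently closed for $U$-extensions if: (i) for every $f:A\to UB$ there is a chosen $U$-extension $(f^{\mathbb D},\mathbb D_f)$ of $f$ along $y_A$; (ii) for every $f:X\to UY$ the 1-cell $1_{UY}^{\mathbb D}\circ(y_{UY}f)^{\mathbb D}:FX\to Y$ together with the 2-cell $$f\xrightarrow{\mathbb D_{1_{UY}}f}U1_{UY}^{\mathbb D}\,y_{UY}f\xrightarrow{U1_{UY}^{\mathbb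 D}\,\mathbb D_{y_{UY}f}}U1_{UY}^{\mathbb D}\,U(y_{UY}f)^{\mathbb D}\,y_X\xrightarrow{\gamma^{-1}y_X}U\big(1_{UY}^{\mathbb D}(y_{UY}f)^{\mathbb D}\big)y_X$$ is a $U$-extension of $f$ along $y_X$. Unit axiom: for every $A$, the pair $(1_{FA},\ \iota^{-1}y_A:y_A\Rightarrow U1_{FA}\circ y_A)$ is a $U$-extension of $y_A$ along $y_A$. Composition axiom: for all $f:A\to B$, $g:B\to C$ in $\mathcal D$, the 1-cell $(y_Cg)^{\mathbb D}(y_Bf)^{\mathbb D}$ with the 2-cell $$y_Cgf\xrightarrow{\mathbb D_{y_Cg}f}U(y_Cg)^{\mathbb D}y_Bf\xrightarrow{U(y_Cg)^{\mathbb D}\mathbb D_{y_Bf}}U(y_Cg)^{\mathbb D}U(y_Bf)^{\mathbb D}y_A\xrightarrow{\gamma^{-1}y_A}U\big((y_Cg)^{\mathbb D}(y_Bf)^{\mathbb D}\big)y_A$$ is a $U$-extension of $y_Cgf$ along $y_A$. *)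

(* Defs.v *)
Set Implicit Arguments.
Unset Strict Implicit.
Unset Printing Implicit Defensive.

Declare Scope twocat_scope.
Delimit Scope twocat_scope with twocat.
Local Open Scope twocat_scope.

(* The identity 2-cell, regarded as a 2-cell between two provably equal 1-cells.
   Since 1-cell composition is associative and unital only propositionally, these
   cells mediate wherever the strictness of a 2-category is used silently. *)
Definition eq_cell (H : Type) (cell : H -> H -> Type) (id2 : forall f, cell f f)
  (f g : H) (e : f = g) : cell f g :=
  match e in _ = x return cell f x with eq_refl => id2 f end.

(* Strict 2-categories.  Vertical composition is in diagrammatic order (first
   [s], then [t], in [vcomp s t]); 1-cell and horizontal composition are in the
   usual order.  The last three laws say that horizontal composition is strictly
   associative and unital. *)
Record twocat : Type := Twocat {
  ob :> Type;
  hom : ob -> ob -> Type;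
  cell : forall A B, hom A B -> hom A B -> Type;
  id1 : forall A, hom A A;
  comp : forall A B C, hom B C -> hom A B -> hom A C;
  id2 : forall A B (f : hom A B), cell f f;
  vcomp : forall A B (f g h : hom A B), cell f g -> cell g h -> cell f h;
  hcomp : forall A B C (g g' : hom B C) (f f' : hom A B),
    cell g g' -> cell f f' -> cell (comp g f) (comp g' f');
  comp_assoc : forall A B C D (h : hom C D) (g : hom B C) (f : hom A B),
    comp h (comp g f) = comp (comp h g) f;
  comp_id1l : forall A B (f : hom A B), comp (id1 B) f = f;
  comp_id1r : forall A B (f : hom A B), comp f (id1 A) = f;
  vcomp_assoc : forall A B (f g h k : hom A B) (s : cell f g) (t : cell g h) (u : cell h k),
    vcomp s (vcomp t u) = vcomp (vcomp s t) u;
  vcomp_id2l : forall A B (f g : hom A B) (s : cell f g), vcomp (id2 f) s = s;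
  vcomp_id2r : forall A B (f g : hom A B) (s : cell f g), vcomp s (id2 g) = s;
  hcomp_id2 : forall A B C (g : hom B C) (f : hom A B),
    hcomp (id2 g) (id2 f) = id2 (comp g f);
  interchange : forall A B C (g g' g'' : hom B C) (f f' f'' : hom A B)
    (t : cell g g') (t' : cell g' g'') (s : cell f f') (s' : cell f' f''),
    hcomp (vcomp t t') (vcomp s s') = vcomp (hcomp t s) (hcomp t' s');
  hcomp_assoc : forall A B C D (h h' : hom C D) (g g' : hom B C) (f f' : hom A B)
    (u : cell h h') (t : cell g g') (s : cell f f'),
    vcomp (hcomp u (hcomp t s)) (eq_cell (@id2 A D) (comp_assoc h' g' f')) =
    vcomp (eq_cell (@id2 A D) (comp_assoc h g f)) (hcomp (hcomp u t) s);
  hcomp_id1l : forall A B (f f' : hom A B) (s : cell f f'),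
    vcomp (hcomp (id2 (id1 B)) s) (eq_cell (@id2 A B) (comp_id1l f')) =
    vcomp (eq_cell (@id2 A B) (comp_id1l f)) s;
  hcomp_id1r : forall A B (f f' : hom A B) (s : cell f f'),
    vcomp (hcomp s (id2 (id1 A))) (eq_cell (@id2 A B) (comp_id1r f')) =
    vcomp (eq_cell (@id2 A B) (comp_id1r f)) s
}.

Arguments hom {C} A B : rename.
Arguments cell {C A B} f g : rename.
Arguments id1 {C} A : rename.
Arguments comp {C A B X} g f : rename.
Arguments id2 {C A B} f : rename.
Arguments vcomp {C A B f g h} _ _ : rename.
Arguments hcomp {C A B X g g' f f'} _ _ : rename.

Notation "g ∘ f" := (comp g f) (at level 40, left associativity) : twocat_scope.
Notation "f ⇒ g" := (cell f g) (at level 70, no associativity) : twocat_scope.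
Notation "s ;; t" := (vcomp s t) (at level 50, left associativity) : twocat_scope.
Notation "t ** s" := (hcomp t s) (at level 40, left associativity) : twocat_scope.
Notation "g ◁ s" := (hcomp (id2 g) s) (at level 45, no associativity) : twocat_scope.
Notation "s ▷ f" := (hcomp s (id2 f)) (at level 45, no associativity) : twocat_scope.

Section Cells.
Context {C : twocat}.

Definition eqc {A B : C} {f g : hom A B} (e : f = g) : f ⇒ g := eq_cell (@id2 C A B) e.

(* The identity 2-cells expressing strict associativity and unitality of 1-cells. *)
Definition assoc {A B X Y : C} (h : hom X Y) (g : hom B X) (f : hom A B) :
  h ∘ (g ∘ f) ⇒ h ∘ g ∘ f := eqc (comp_assoc h g f).
Definition assocV {A B X Y : C} (h : hom X Y) (g : hom B X) (f : hom A B) :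
  h ∘ g ∘ f ⇒ h ∘ (g ∘ f) := eqc (eq_sym (comp_assoc h g f)).
Definition lunit {A B : C} (f : hom A B) : id1 B ∘ f ⇒ f := eqc (comp_id1l f).
Definition lunitV {A B : C} (f : hom A B) : f ⇒ id1 B ∘ f := eqc (eq_sym (comp_id1l f)).
Definition runit {A B : C} (f : hom A B) : f ∘ id1 A ⇒ f := eqc (comp_id1r f).
Definition runitV {A B : C} (f : hom A B) : f ⇒ f ∘ id1 A := eqc (eq_sym (comp_id1r f)).

Definition is_inverse {A B : C} {f g : hom A B} (s : f ⇒ g) (t : g ⇒ f) : Prop :=
  s ;; t = id2 f /\ t ;; s = id2 g.

End Cells.

(* The action of a functor on 0-cells and 1-cells.  Components of colax natural
   transformations are typed over this part only.  Primitive projections make the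
   composition [map1_comp] associative and unital up to conversion. *)
Set Primitive Projections.
Record map1 (C D : twocat) : Type := Map1 {
  mob :> C -> D;
  m1 : forall A B : C, hom A B -> hom (mob A) (mob B)
}.
Unset Primitive Projections.
Arguments m1 {C D} m {A B} f.

Definition map1_id (C : twocat) : map1 C C := Map1 (fun A B (f : hom A B) => f).
Definition map1_comp (C D E : twocat) (G : map1 D E) (H : map1 C D) : map1 C E :=
  @Map1 C E (fun A => G (H A)) (fun A B f => m1 G (m1 H f)).

Record colax_str (C D : twocat) (H : map1 C D) : Type := ColaxStr {
  str2 : forall (A B : C) (f g : hom A B), f ⇒ g -> m1 H f ⇒ m1 H g;
  str_gamma : forall (A B X : C) (g : hom B X) (f : hom A B),
    m1 H (g ∘ f) ⇒ m1 H g ∘ m1 H f;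
  str_iota : forall A : C, m1 H (id1 A) ⇒ id1 (H A)
}.

Record colax_data (C D : twocat) : Type := ColaxData {
  cmap :> map1 C D;
  cstr : colax_str cmap
}.

Definition m2 {C D : twocat} (H : colax_data C D) {A B : C} {f g : hom A B} (s : f ⇒ g) :
  m1 H f ⇒ m1 H g := str2 (cstr H) s.
Definition gamma {C D : twocat} (H : colax_data C D) {A B X : C} (g : hom B X) (f : hom A B) :
  m1 H (g ∘ f) ⇒ m1 H g ∘ m1 H f := str_gamma (cstr H) g f.
Definition iota {C D : twocat} (H : colax_data C D) (A : C) :
  m1 H (id1 A) ⇒ id1 (H A) := str_iota (cstr H) A.

Record is_colax_functor (C D : twocat) (H : colax_data C D) : Prop := IsColaxFunctor {
  m2_id : forall (A B : C) (f : hom A B), m2 H (id2 f) = id2 (m1 H f);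
  m2_vcomp : forall (A B : C) (f g h : hom A B) (s : f ⇒ g) (t : g ⇒ h),
    m2 H (s ;; t) = m2 H s ;; m2 H t;
  gamma_nat : forall (A B X : C) (g g' : hom B X) (f f' : hom A B)
    (t : g ⇒ g') (s : f ⇒ f'),
    m2 H (t ** s) ;; gamma H g' f' = gamma H g f ;; (m2 H t ** m2 H s);
  gamma_assoc : forall (A B X Y : C) (h : hom X Y) (g : hom B X) (f : hom A B),
    gamma H h (g ∘ f) ;; (m1 H h ◁ gamma H g f) ;; assoc (m1 H h) (m1 H g) (m1 H f) =
    m2 H (assoc h g f) ;; gamma H (h ∘ g) f ;; (gamma H h g ▷ m1 H f);
  gamma_unitl : forall (A B : C) (f : hom A B),
    gamma H (id1 B) f ;; (iota H B ▷ m1 H f) ;; lunit (m1 H f) = m2 H (lunit f);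
  gamma_unitr : forall (A B : C) (f : hom A B),
    gamma H f (id1 A) ;; (m1 H f ◁ iota H A) ;; runit (m1 H f) = m2 H (runit f)
}.

(* Inverse 2-cells are unique, so carrying them as data adds no structure. *)
Record is_pseudofunctor (C D : twocat) (H : colax_data C D) : Type := IsPseudofunctor {
  pseudo_colax : is_colax_functor H;
  pseudo_gammaV : forall (A B X : C) (g : hom B X) (f : hom A B),
    m1 H g ∘ m1 H f ⇒ m1 H (g ∘ f);
  pseudo_iotaV : forall A : C, id1 (H A) ⇒ m1 H (id1 A);
  pseudo_gammaK : forall (A B X : C) (g : hom B X) (f : hom A B),
    is_inverse (gamma H g f) (pseudo_gammaV g f);
  pseudo_iotaK : forall A : C, is_inverse (iota H A) (pseudo_iotaV A)
}.

Record pseudofunctor (C D : twocat) : Type := Pseudofunctor {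
  pdata :> colax_data C D;
  plaws : is_pseudofunctor pdata
}.

Definition gammaV {C D : twocat} (H : pseudofunctor C D) {A B X : C}
  (g : hom B X) (f : hom A B) : m1 H g ∘ m1 H f ⇒ m1 H (g ∘ f) :=
  pseudo_gammaV (plaws H) g f.
Definition iotaV {C D : twocat} (H : pseudofunctor C D) (A : C) :
  id1 (H A) ⇒ m1 H (id1 A) := pseudo_iotaV (plaws H) A.

Definition functor_id (C : twocat) : colax_data C C :=
  @ColaxData C C (map1_id C)
    (@ColaxStr C C (map1_id C) (fun A B f g s => s)
       (fun A B X g f => id2 (g ∘ f)) (fun A => id2 (id1 A))).

Definition functor_comp (C D E : twocat) (G : colax_data D E) (H : colax_data C D) :
  colax_data C E :=
  @ColaxData C E (map1_comp G H)
    (@ColaxStr C E (map1_comp G H) (fun A B f g s => m2 G (m2 H s))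
       (fun A B X g f => m2 G (gamma H g f) ;; gamma G (m1 H g) (m1 H f))
       (fun A => m2 G (iota H A) ;; iota G (H A))).

Record trans (C D : twocat) (H G : map1 C D) : Type := Trans {
  tc :> forall A : C, hom (H A) (G A);
  tsq : forall (A B : C) (f : hom A B), tc B ∘ m1 H f ⇒ m1 G f ∘ tc A
}.
Arguments tsq {C D H G} t {A B} f.

Record is_colax_nat (C D : twocat) (H G : colax_data C D) (a : trans H G) : Prop :=
  IsColaxNat {
  tsq_nat : forall (A B : C) (f g : hom A B) (s : f ⇒ g),
    (a B ◁ m2 H s) ;; tsq a g = tsq a f ;; (m2 G s ▷ a A);
  tsq_comp : forall (A B X : C) (g : hom B X) (f : hom A B),
    tsq a (g ∘ f) ;; (gamma G g f ▷ a A) =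
    (a X ◁ gamma H g f) ;; assoc (a X) (m1 H g) (m1 H f) ;; (tsq a g ▷ m1 H f)
      ;; assocV (m1 G g) (a B) (m1 H f) ;; (m1 G g ◁ tsq a f)
      ;; assoc (m1 G g) (m1 G f) (a A);
  tsq_id : forall A : C,
    tsq a (id1 A) ;; (iota G A ▷ a A) ;; lunit (a A) =
    (a A ◁ iota H A) ;; runit (a A)
}.
Arguments is_colax_nat {C D} H G a.

Definition trans_id (C D : twocat) (H : map1 C D) : trans H H :=
  @Trans C D H H (fun A => id1 (H A))
    (fun A B f => lunit (m1 H f) ;; runitV (m1 H f)).

Definition trans_comp (C D : twocat) (H G K : map1 C D) (b : trans G K) (a : trans H G) :
  trans H K :=
  @Trans C D H K (fun A => b A ∘ a A)
    (fun A B f =>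
       assocV (b B) (a B) (m1 H f) ;; (b B ◁ tsq a f) ;; assoc (b B) (m1 G f) (a A)
         ;; (tsq b f ▷ a A) ;; assocV (m1 K f) (b A) (a A)).

(* The transformation written [a K]. *)
Definition trans_pre (C D E : twocat) (H G : map1 D E) (a : trans H G) (K : map1 C D) :
  trans (map1_comp H K) (map1_comp G K) :=
  @Trans C E (map1_comp H K) (map1_comp G K) (fun A => a (K A)) (fun A B f => tsq a (m1 K f)).

(* The transformation written [K a]. *)
Definition trans_post (C D E : twocat) (K : pseudofunctor D E) (H G : map1 C D)
  (a : trans H G) : trans (map1_comp K H) (map1_comp K G) :=
  @Trans C E (map1_comp K H) (map1_comp K G) (fun A => m1 K (a A))
    (fun A B f =>
       gammaV K (a B) (m1 H f) ;; m2 K (tsq a f) ;; gamma K (m1 G f) (a A)).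

Definition is_modification (C D : twocat) (H G : map1 C D) (a b : trans H G)
  (Gam : forall A : C, a A ⇒ b A) : Prop :=
  forall (A B : C) (f : hom A B),
    tsq a f ;; (m1 G f ◁ Gam A) = (Gam B ▷ m1 H f) ;; tsq b f.
Arguments is_modification {C D H G} a b Gam.

Definition is_invertible_modification (C D : twocat) (H G : map1 C D) (a b : trans H G)
  (Gam : forall A : C, a A ⇒ b A) : Prop :=
  is_modification a b Gam /\
  exists GamV : forall A : C, b A ⇒ a A,
    is_modification b a GamV /\ forall A : C, is_inverse (Gam A) (GamV A).
Arguments is_invertible_modification {C D H G} a b Gam.

(* In the next two definitions [F 1] and [1 F] (resp. [1 U] and [U 1]) are [F]
   (resp. [U]) up to conversion, so the composites are typed without coercions. *)
Definition eps_F_eta (X Y : twocat) (F : pseudofunctor X Y) (U : map1 Y X)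
  (eps : trans (map1_comp F U) (map1_id Y)) (eta : trans (map1_id X) (map1_comp U F)) :
  trans F F :=
  trans_comp (trans_pre eps F) (trans_post F eta).

Definition U_eps_eta (X Y : twocat) (F : map1 X Y) (U : pseudofunctor Y X)
  (eps : trans (map1_comp F U) (map1_id Y)) (eta : trans (map1_id X) (map1_comp U F)) :
  trans U U :=
  trans_comp (trans_post U eps) (trans_pre eta U).

Section ColaxAdjunction.
Variables (X Y : twocat) (F : pseudofunctor X Y) (U : pseudofunctor Y X).
Variables (eta : trans (map1_id X) (map1_comp U F))
          (eps : trans (map1_comp F U) (map1_id Y)).
Variables (Psi : forall A : X, eps_F_eta eps eta A ⇒ trans_id F A)
          (Phi : forall B : Y, trans_id U B ⇒ U_eps_eta eps eta B).

Definition U_Psi (A : X) : m1 U (eps (F A)) ∘ m1 U (m1 F (eta A)) ⇒ id1 (U (F A)) :=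
  gammaV U (eps (F A)) (m1 F (eta A)) ;; m2 U (Psi A) ;; iota U (F A).

Definition F_Phi (B : Y) : id1 (F (U B)) ⇒ m1 F (m1 U (eps B)) ∘ m1 F (eta (U B)) :=
  iotaV F (U B) ;; m2 F (Phi B) ;; gamma F (m1 U (eps B)) (eta (U B)).

Definition swallowtail_eta (A : X) : eta A ⇒ eta A :=
  lunitV (eta A)
    ;; (Phi (F A) ▷ eta A)
    ;; assocV (m1 U (eps (F A))) (eta (U (F A))) (eta A)
    ;; (m1 U (eps (F A)) ◁ tsq eta (eta A))
    ;; assoc (m1 U (eps (F A))) (m1 U (m1 F (eta A))) (eta A)
    ;; (U_Psi A ▷ eta A)
    ;; lunit (eta A).

Definition swallowtail_eps (B : Y) : eps B ⇒ eps B :=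
  runitV (eps B)
    ;; (eps B ◁ F_Phi B)
    ;; assoc (eps B) (m1 F (m1 U (eps B))) (m1 F (eta (U B)))
    ;; (tsq eps (eps B) ▷ m1 F (eta (U B)))
    ;; assocV (eps B) (eps (F (U B))) (m1 F (eta (U B)))
    ;; (eps B ◁ Psi (U B))
    ;; runit (eps B).

Record is_colax_adjunction : Prop := IsColaxAdjunction {
  adj_eta : is_colax_nat (functor_id X) (functor_comp U F) eta;
  adj_eps : is_colax_nat (functor_comp F U) (functor_id Y) eps;
  adj_Psi : is_modification (eps_F_eta eps eta) (trans_id F) Psi;
  adj_Phi : is_modification (trans_id U) (U_eps_eta eps eta) Phi;
  adj_swallowtail_eta : forall A : X, swallowtail_eta A = id2 (eta A);
  adj_swallowtail_eps : forall B : Y, swallowtail_eps B = id2 (eps B)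
}.

End ColaxAdjunction.
Arguments is_colax_adjunction {X Y} F U eta eps Psi Phi.

Section UExtensions.
Variables (C D : twocat) (U : pseudofunctor C D).

(* [FA] is only an object of [C] with a 1-cell [yA : A -> U FA]. *)
Definition is_Uext (A : D) (FA B : C) (yA : hom A (U FA)) (f : hom A (U B))
  (f' : hom FA B) (psi : f ⇒ m1 U f' ∘ yA) : Prop :=
  forall (g : hom FA B) (a : f ⇒ m1 U g ∘ yA),
    exists! theta : f' ⇒ g, psi ;; (m2 U theta ▷ yA) = a.

(* The pasting common to coherent closure and to the composition axiom:
   k f -> U u (yB f) -> U u (U v yA) -> U (u v) yA. *)
Definition paste_ext (A B : D) (FA FB Z : C) (yA : hom A (U FA)) (yB : hom B (U FB))
  (k : hom B (U Z)) (f : hom A B) (u : hom FB Z) (v : hom FA FB)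
  (s : k ⇒ m1 U u ∘ yB) (t : yB ∘ f ⇒ m1 U v ∘ yA) :
  k ∘ f ⇒ m1 U (u ∘ v) ∘ yA :=
  (s ▷ f) ;; assocV (m1 U u) yB f ;; (m1 U u ◁ t) ;; assoc (m1 U u) (m1 U v) yA
    ;; (gammaV U u v ▷ yA).

Variables (F0 : D -> C) (y : forall A : D, hom A (U (F0 A))).

Record coherently_closed : Type := CoherentlyClosed {
  dext : forall (A : D) (B : C), hom A (U B) -> hom (F0 A) B;
  dcell : forall (A : D) (B : C) (f : hom A (U B)), f ⇒ m1 U (dext f) ∘ y A;
  dext_Uext : forall (A : D) (B : C) (f : hom A (U B)), is_Uext (dcell f);
  dext_coherent : forall (X : D) (Y : C) (f : hom X (U Y)),
    @is_Uext X (F0 X) Y (y X) f (dext (id1 (U Y)) ∘ dext (y (U Y) ∘ f))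
      (lunitV f ;; paste_ext (dcell (id1 (U Y))) (dcell (y (U Y) ∘ f)))
}.

Variable cc : coherently_closed.

Definition unit_axiom : Prop :=
  forall A : D, @is_Uext A (F0 A) (F0 A) (y A) (y A) (id1 (F0 A))
    (lunitV (y A) ;; (iotaV U (F0 A) ▷ y A)).

Definition composition_axiom : Prop :=
  forall (A B X : D) (f : hom A B) (g : hom B X),
    @is_Uext A (F0 A) (F0 X) (y A) (y X ∘ (g ∘ f))
      (dext cc (y X ∘ g) ∘ dext cc (y B ∘ f))
      (assoc (y X) g f ;; paste_ext (dcell cc (y X ∘ g)) (dcell cc (y B ∘ f))).

Definition ext_map1 : map1 D C :=
  @Map1 D C F0 (fun (A B : D) (f : hom A B) => dext cc (y B ∘ f)).

Definition ext_unit : trans (map1_id D) (map1_comp U ext_map1) :=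
  @Trans D D (map1_id D) (map1_comp U ext_map1) y
    (fun (A B : D) (f : hom A B) => dcell cc (y B ∘ f)).

Definition ext_counit1 (B : C) : hom (F0 (U B)) B := dext cc (id1 (U B)).

Definition ext_counit_squares : Type :=
  forall (B B' : C) (h : hom B B'),
    ext_counit1 B' ∘ m1 ext_map1 (m1 U h) ⇒ h ∘ ext_counit1 B.

Definition ext_counit (e : ext_counit_squares) : trans (map1_comp ext_map1 U) (map1_id C) :=
  @Trans C C (map1_comp ext_map1 U) (map1_id C) ext_counit1 e.

Definition ext_Phi (B : C) : id1 (U B) ⇒ m1 U (ext_counit1 B) ∘ y (U B) :=
  dcell cc (id1 (U B)).

End UExtensions.

(* Main.v *)
From Stdlib Require Import ClassicalEpsilon FunctionalExtensionality ProofIrrelevance.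
Require Import Defs.
Set Implicit Arguments.
Unset Strict Implicit.
Local Open Scope twocat_scope.

(** Write [d f : y B ∘ f ⇒ U(F f) ∘ y A] for the extension cell of [y B ∘ f] along [y A], and
    [phi B : 1 ⇒ U(eps B) ∘ y (U B)] for that of the identity of [U B].  A 2-cell [θ : F f ⇒ g]
    and its transpose [d f ⋄ θ], which is [d f] followed by [Uθ ∘ y A], determine each other,
    and this is what makes the theorem true: the transposition equations in [unit_eqs], which
    are colax naturality of [y] read one axiom at a time, have exactly one solution for the
    action of [F] on 2-cells and for its structure cells, and the equation in [counit_eqs],
    which is the modification axiom for [phi], has exactly one solution for the squares of
    the counit.  The latter lives on the 1-cell [eps B' ∘ F(U h)], and coherent closure says
    that this 1-cell carries a U-extension too.

    Every law about 2-cells out of a U-extension may now be checked on transposes.  There it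
    becomes an identity between pastings of squares [q ∘ f ⇒ U u ∘ p], whose vertical sides
    [p] and [q] go from an object of [D] to the image under [U] of an object of [C].
    The operation [paste] puts two squares side by side; it is natural ([paste_postcomp],
    [paste_precomp]), associative ([paste_assoc]) and unital ([paste_unitl], [paste_unitr])
    because the structure cells of [U] are, and the laws of [F] and of the counit follow
    formally ([colax_functor_FS], [colax_nat_counit]).

    The composition axiom says that the pasting of [d g] and [d f] is a U-extension of the
    same 1-cell as [d (g ∘ f)], and the unit axiom that the unit square on [y A] is a
    U-extension of the same 1-cell as [d 1].  Hence the structure cells of [F] compare two
    U-extensions of one 1-cell and are invertible ([pseudofunctor_FS]).  In the same way
    [Psi A] compares the two U-extensions of [y A], one from coherent closure and one from
    the unit axiom.  The first swallowtail identity restates the definition of [Psi];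
    the second one and the modification axiom for [Psi] both reduce to [counit_collapse].

    Since 1-cells compose associatively only up to a propositional equality, these
    computations are carried out on floating cells, that is, 2-cells bundled with their
    boundary.  On these the identity 2-cells mediating between equal 1-cells become
    identities, and horizontal composition is associative and unital on the nose. *)

(** * Cells with a floating boundary *)

(** The cell is optional because the vertical composite of two cells with different
    boundaries has to be something: it is undefined, but still has a source and a target.
    Keeping these outside the option lets the boundary of any expression be computed without
    knowing whether the expression is defined. *)
Record fcell {C : twocat} (A B : C) : Type := Fcell {
  src : hom A B;
  tgt : hom A B;
  val : option (src ⇒ tgt)
}.

Definition float {C : twocat} {A B : C} {f g : hom A B} (s : f ⇒ g) : fcell A B :=
  @Fcell C A B f g (Some s).

Definition fvcomp {C : twocat} {A B : C} (x y : fcell A B) : fcell A B :=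
  @Fcell C A B (src x) (tgt y)
    match val x, val y, excluded_middle_informative (tgt x = src y) with
    | Some s, Some t, left e => Some (s ;; eqc e ;; t)
    | _, _, _ => None
    end.

Definition fhcomp {C : twocat} {A B X : C} (x : fcell B X) (y : fcell A B) : fcell A X :=
  @Fcell C A X (src x ∘ src y) (tgt x ∘ tgt y)
    match val x, val y with
    | Some t, Some s => Some (t ** s)
    | _, _ => None
    end.

Notation "⌊ s ⌋" := (float s) (at level 0, s at level 200) : twocat_scope.
Notation "⟨ f ⟩" := (float (id2 f)) (at level 0, f at level 200) : twocat_scope.
Notation "x ⋅ y" := (fvcomp x y) (at level 50, left associativity) : twocat_scope.
Notation "x ⊗ y" := (fhcomp x y) (at level 40, left associativity) : twocat_scope.

Section FloatingCells.
Context {C : twocat}.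

Lemma float_eq (A B : C) (f g f' g' : hom A B) (s : f ⇒ g) (t : f' ⇒ g')
  (e1 : f = f') (e2 : g = g') : s ;; eqc e2 = eqc e1 ;; t -> ⌊s⌋ = ⌊t⌋.
Proof.
  destruct e1, e2; unfold eqc; cbn; rewrite vcomp_id2r, vcomp_id2l; now intros ->.
Qed.

(** Handles the undefined case in the laws of horizontal composition. *)
Lemma undefined_eq (A B : C) (f g f' g' : hom A B) :
  f = f' -> g = g' -> @Fcell C A B f g None = @Fcell C A B f' g' None.
Proof. now intros <- <-. Qed.

(** Proof irrelevance for equations between 1-cells enters here: floating forgets the
    boundary, and two equal boundaries can then be identified in one way only. *)
Lemma float_inj (A B : C) (f g : hom A B) (s t : f ⇒ g) : ⌊s⌋ = ⌊t⌋ -> s = t.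
Proof.
  intro E; unfold float in E.
  (* The equality of the cells is generalised over equations between their boundaries. *)
  assert (H : forall x y : fcell A B, x = y -> forall (a : src x = src y) (b : tgt x = tgt y),
    match val x, val y with
    | Some s, Some t => s ;; eqc b = eqc a ;; t
    | None, None => True
    | _, _ => False
    end).
  { intros x y <- a b.
    rewrite (proof_irrelevance _ a eq_refl), (proof_irrelevance _ b eq_refl).
    destruct (val x); [|exact I]; unfold eqc; cbn.
    now rewrite vcomp_id2r, vcomp_id2l. }
  specialize (H _ _ E eq_refl eq_refl); cbn in H; unfold eqc in H; cbn in H.
  now rewrite vcomp_id2r, vcomp_id2l in H.
Qed.

Lemma float_iff (A B : C) (f g : hom A B) (s t : f ⇒ g) : ⌊s⌋ = ⌊t⌋ <-> s = t.
Proof. split; [apply float_inj | now intros ->]. Qed.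

Lemma float_eqc (A B : C) (f g : hom A B) (e : f = g) : ⌊eqc e⌋ = ⟨f⟩.
Proof. now destruct e. Qed.

Lemma float_vcomp_eqc (A B : C) (f g h : hom A B) (s : f ⇒ g) (e : g = h) :
  ⌊s ;; eqc e⌋ = ⌊s⌋.
Proof. destruct e; unfold eqc; cbn; now rewrite vcomp_id2r. Qed.

Lemma float_vcomp (A B : C) (f g h : hom A B) (s : f ⇒ g) (t : g ⇒ h) :
  ⌊s ;; t⌋ = ⌊s⌋ ⋅ ⌊t⌋.
Proof.
  unfold fvcomp, float; cbn.
  destruct excluded_middle_informative as [e|n]; [|now destruct n].
  rewrite (proof_irrelevance _ e eq_refl); unfold eqc; cbn.
  now rewrite vcomp_id2r.
Qed.

Lemma float_hcomp (A B X : C) (g g' : hom B X) (f f' : hom A B) (t : g ⇒ g') (s : f ⇒ f') :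
  ⌊t ** s⌋ = ⌊t⌋ ⊗ ⌊s⌋.
Proof. reflexivity. Qed.

Lemma fvcompA (A B : C) (x y z : fcell A B) : x ⋅ (y ⋅ z) = x ⋅ y ⋅ z.
Proof.
  unfold fvcomp; cbn; f_equal.
  destruct (val x), (val y), (val z);
    destruct (excluded_middle_informative (tgt x = src y));
    destruct (excluded_middle_informative (tgt y = src z)); try reflexivity.
  now rewrite !vcomp_assoc.
Qed.

Lemma fvcomp_idl (A B : C) (f : hom A B) (x : fcell A B) : f = src x -> ⟨f⟩ ⋅ x = x.
Proof.
  intros ->; destruct x as [f g [s|]]; cbn.
  - change (⟨f⟩ ⋅ ⌊s⌋ = ⌊s⌋); now rewrite <- float_vcomp, vcomp_id2l.
  - reflexivity.
Qed.

Lemma fvcomp_idr (A B : C) (f : hom A B) (x : fcell A B) : f = tgt x -> x ⋅ ⟨f⟩ = x.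
Proof.
  intros ->; destruct x as [f g [s|]]; cbn.
  - change (⌊s⌋ ⋅ ⟨g⟩ = ⌊s⌋); now rewrite <- float_vcomp, vcomp_id2r.
  - reflexivity.
Qed.

Lemma float_id_comp (A B X : C) (g : hom B X) (f : hom A B) : ⟨g ∘ f⟩ = ⟨g⟩ ⊗ ⟨f⟩.
Proof. rewrite <- float_hcomp; now rewrite hcomp_id2. Qed.

Lemma fhcompA (A B X Y : C) (x : fcell X Y) (y : fcell B X) (z : fcell A B) :
  x ⊗ (y ⊗ z) = x ⊗ y ⊗ z.
Proof.
  destruct x as [h h' [u|]], y as [g g' [t|]], z as [f f' [s|]];
    try (apply undefined_eq; apply comp_assoc).
  exact (float_eq (hcomp_assoc u t s)).
Qed.

Lemma fhcomp_idl (A B : C) (x : fcell A B) : ⟨id1 B⟩ ⊗ x = x.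
Proof.
  destruct x as [f g [s|]]; [|apply undefined_eq; apply comp_id1l].
  exact (float_eq (hcomp_id1l s)).
Qed.

Lemma fhcomp_idr (A B : C) (x : fcell A B) : x ⊗ ⟨id1 A⟩ = x.
Proof.
  destruct x as [f g [s|]]; [|apply undefined_eq; apply comp_id1r].
  exact (float_eq (hcomp_id1r s)).
Qed.

(** Without the two hypotheses the right-hand side may be defined when the left-hand side
    is not, since distinct pairs of 1-cells can have the same composite. *)
Lemma finterchange (A B X : C) (x x' : fcell B X) (y y' : fcell A B) :
  tgt x = src x' -> tgt y = src y' -> (x ⋅ x') ⊗ (y ⋅ y') = (x ⊗ y) ⋅ (x' ⊗ y').
Proof.
  destruct x as [f1 g1 ox], x' as [f2 g2 ox'], y as [f3 g3 oy], y' as [f4 g4 oy'];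
    cbn; intros -> ->.
  destruct ox as [t|], ox' as [t'|], oy as [s|], oy' as [s'|]; try reflexivity.
  all: try (unfold fvcomp, fhcomp; cbn; f_equal;
    repeat destruct excluded_middle_informative; reflexivity).
  change ((⌊t⌋ ⋅ ⌊t'⌋) ⊗ (⌊s⌋ ⋅ ⌊s'⌋) = (⌊t⌋ ⊗ ⌊s⌋) ⋅ (⌊t'⌋ ⊗ ⌊s'⌋)).
  now rewrite <- !float_hcomp, <- !float_vcomp, <- float_hcomp, interchange.
Qed.

End FloatingCells.

Lemma fhcomp_rl {C : twocat} {A B X : C} (x : fcell B X) (y : fcell A B) (f : hom A B)
  (g : hom B X) : f = src y -> g = tgt x -> (x ⊗ ⟨f⟩) ⋅ (⟨g⟩ ⊗ y) = x ⊗ y.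
Proof.
  intros -> ->; rewrite <- finterchange by reflexivity.
  now rewrite fvcomp_idl, fvcomp_idr.
Qed.

Lemma fhcomp_lr {C : twocat} {A B X : C} (x : fcell B X) (y : fcell A B) (f : hom A B)
  (g : hom B X) : f = tgt y -> g = src x -> (⟨g⟩ ⊗ y) ⋅ (x ⊗ ⟨f⟩) = x ⊗ y.
Proof.
  intros -> ->; rewrite <- finterchange by reflexivity.
  now rewrite fvcomp_idl, fvcomp_idr.
Qed.

Lemma fwhisker_l {C : twocat} {A B X : C} (x y : fcell A B) (g : hom B X) :
  tgt x = src y -> ⟨g⟩ ⊗ (x ⋅ y) = (⟨g⟩ ⊗ x) ⋅ (⟨g⟩ ⊗ y).
Proof.
  intros e; rewrite <- finterchange by (reflexivity || exact e).
  now rewrite fvcomp_idl.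
Qed.

Lemma fwhisker_r {C : twocat} {A B X : C} (x y : fcell B X) (f : hom A B) :
  tgt x = src y -> (x ⋅ y) ⊗ ⟨f⟩ = (x ⊗ ⟨f⟩) ⋅ (y ⊗ ⟨f⟩).
Proof.
  intros e; rewrite <- finterchange by (reflexivity || exact e).
  now rewrite (fvcomp_idl (f:=f) (x:=⟨f⟩)).
Qed.

(** Rewrites two consecutive factors inside a longer vertical composite. *)
Lemma fvcomp_at {C : twocat} {A B : C} (x y z : fcell A B) :
  x ⋅ y = z -> forall w, w ⋅ x ⋅ y = w ⋅ z.
Proof. intros <- w; symmetry; apply fvcompA. Qed.

(** * Pseudofunctors on floating cells *)

Definition fmap {C D : twocat} (U : pseudofunctor C D) {A B : C}
  (x : fcell A B) : fcell (U A) (U B) :=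
  @Fcell D (U A) (U B) (m1 U (src x)) (m1 U (tgt x)) (option_map (fun s => m2 U s) (val x)).

(** The transpose of [a] when [x] is an extension cell along [p]; in general, the
    postcomposition of a square [x] with the 2-cell [a] along its lower side. *)
Notation "x ⋄ [ p ] a" := (x ⋅ (fmap _ a ⊗ ⟨p⟩))
  (at level 50, p at level 200, left associativity, format "x  ⋄ [ p ]  a") : twocat_scope.

(** Proves that boundaries agree: once sources and targets are computed, such equations hold
    by associativity and unitality of the composition of 1-cells. *)
Ltac boundary :=
  cbn [src tgt float fvcomp fhcomp fmap];
  rewrite <- ?comp_assoc, ?comp_id1l, ?comp_id1r in *;
  repeat match goal with
  | H : src _ = _ |- _ => rewrite H
  | H : tgt _ = _ |- _ => rewrite H
  end;
  rewrite <- ?comp_assoc, ?comp_id1l, ?comp_id1r;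
  reflexivity.

Section PseudofunctorLaws.
Context {C D : twocat} (U : pseudofunctor C D).

Lemma fmap_id (A B : C) (f : hom A B) : fmap U ⟨f⟩ = ⟨m1 U f⟩.
Proof.
  unfold fmap, float; cbn; now rewrite (m2_id (pseudo_colax (plaws U))).
Qed.

Lemma fmap_vcomp (A B : C) (x y : fcell A B) :
  tgt x = src y -> fmap U (x ⋅ y) = fmap U x ⋅ fmap U y.
Proof.
  destruct x as [f g [s|]], y as [g' h [t|]]; cbn; intro e; subst g'; try reflexivity.
  - change (fmap U (⌊s⌋ ⋅ ⌊t⌋) = ⌊m2 U s⌋ ⋅ ⌊m2 U t⌋).
    rewrite <- !float_vcomp; change (⌊m2 U (s ;; t)⌋ = ⌊m2 U s ;; m2 U t⌋).
    now rewrite (m2_vcomp (pseudo_colax (plaws U))).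
Qed.

(** The boundary 1-cells are separate variables so that the lemma can be used for rewriting. *)
Lemma gammaV_nat (A B X : C) (x : fcell B X) (y : fcell A B) u v u' v' :
  u = src x -> v = src y -> u' = tgt x -> v' = tgt y ->
  ⌊gammaV U u v⌋ ⋅ fmap U (x ⊗ y) = (fmap U x ⊗ fmap U y) ⋅ ⌊gammaV U u' v'⌋.
Proof.
  intros -> -> -> ->.
  destruct x as [g g' [t|]], y as [f f' [s|]]; try reflexivity.
  change (⌊gammaV U g f⌋ ⋅ ⌊m2 U (t ** s)⌋ = ⌊m2 U t ** m2 U s⌋ ⋅ ⌊gammaV U g' f'⌋).
  rewrite <- !float_vcomp; f_equal.
  pose proof (gamma_nat (pseudo_colax (plaws U)) t s) as N.
  destruct (pseudo_gammaK (plaws U) g f) as [K1 K2].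
  destruct (pseudo_gammaK (plaws U) g' f') as [K1' K2'].
  fold (gammaV U g f) in K1, K2; fold (gammaV U g' f') in K1', K2'.
  rewrite <- (vcomp_id2r (m2 U (t ** s))), <- K1'.
  rewrite (vcomp_assoc (m2 U (t ** s))), N, !vcomp_assoc, K2.
  now rewrite vcomp_id2l.
Qed.

Lemma gammaV_gamma (A B X : C) (g : hom B X) (f : hom A B) :
  ⌊gammaV U g f⌋ ⋅ ⌊gamma U g f⌋ = ⟨m1 U g ∘ m1 U f⟩.
Proof.
  rewrite <- float_vcomp; f_equal; apply (pseudo_gammaK (plaws U) g f).
Qed.

Lemma gamma_gammaV (A B X : C) (g : hom B X) (f : hom A B) :
  ⌊gamma U g f⌋ ⋅ ⌊gammaV U g f⌋ = ⟨m1 U (g ∘ f)⟩.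
Proof.
  rewrite <- float_vcomp; f_equal; apply (pseudo_gammaK (plaws U) g f).
Qed.

Lemma iotaV_iota (A : C) : ⌊iotaV U A⌋ ⋅ ⌊iota U A⌋ = ⟨id1 (U A)⟩.
Proof. rewrite <- float_vcomp; f_equal; apply (pseudo_iotaK (plaws U) A). Qed.

Lemma iota_iotaV (A : C) : ⌊iota U A⌋ ⋅ ⌊iotaV U A⌋ = ⟨m1 U (id1 A)⟩.
Proof. rewrite <- float_vcomp; f_equal; apply (pseudo_iotaK (plaws U) A). Qed.

Lemma float_m2_eqc (A B : C) (f g : hom A B) (e : f = g) : ⌊m2 U (eqc e)⌋ = ⟨m1 U f⟩.
Proof.
  destruct e; exact (fmap_id f).
Qed.

Lemma gammaV_assoc (A B X Y : C) (h : hom X Y) (g : hom B X) (f : hom A B) :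
  (⟨m1 U h⟩ ⊗ ⌊gammaV U g f⌋) ⋅ ⌊gammaV U h (g ∘ f)⌋ =
  (⌊gammaV U h g⌋ ⊗ ⟨m1 U f⟩) ⋅ ⌊gammaV U (h ∘ g) f⌋.
Proof.
  pose proof (f_equal (fun s => ⌊s⌋) (gamma_assoc (pseudo_colax (plaws U)) h g f)) as G.
  cbv beta in G.
  rewrite !float_vcomp in G; unfold assoc in G.
  rewrite float_eqc, float_m2_eqc, fvcomp_idr in G by reflexivity.
  rewrite fvcomp_idl in G by boundary.
  rewrite !float_hcomp in G.
  (* Between the two sides, insert one of the two equal composites of [gamma]: it cancels
     with the right factor as it stands, and with the left one after rewriting by [G]. *)
  transitivity ((⟨m1 U h⟩ ⊗ ⌊gammaV U g f⌋) ⋅ ⌊gammaV U h (g ∘ f)⌋ ⋅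
    (⌊gamma U (h ∘ g) f⌋ ⋅ (⌊gamma U h g⌋ ⊗ ⟨m1 U f⟩)) ⋅
     (⌊gammaV U h g⌋ ⊗ ⟨m1 U f⟩) ⋅ ⌊gammaV U (h ∘ g) f⌋).
  - rewrite (fvcompA _ ⌊gamma U (h ∘ g) f⌋).
    rewrite (fvcomp_at (eq_sym
      (fwhisker_r (x := ⌊gamma U h g⌋) (y := ⌊gammaV U h g⌋) _ eq_refl))), gamma_gammaV.
    rewrite <- float_id_comp, fvcomp_idr by reflexivity.
    rewrite (fvcomp_at (gamma_gammaV _ _)), fvcomp_idr; [reflexivity | boundary].
  - rewrite <- G, !fvcompA, (fvcomp_at (gammaV_gamma _ _)), fvcomp_idr by reflexivity.
    rewrite <- fwhisker_l, gammaV_gamma by reflexivity.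
    rewrite <- float_id_comp, (fvcomp_idl (x := _ ⊗ _)); [reflexivity | boundary].
Qed.

Lemma gammaV_unitl (A B : C) (f : hom A B) :
  (⌊iotaV U B⌋ ⊗ ⟨m1 U f⟩) ⋅ ⌊gammaV U (id1 B) f⌋ = ⟨m1 U f⟩.
Proof.
  pose proof (f_equal (fun s => ⌊s⌋) (gamma_unitl (pseudo_colax (plaws U)) f)) as G.
  cbv beta in G.
  rewrite !float_vcomp in G; unfold lunit in G.
  rewrite float_eqc, float_m2_eqc, fvcomp_idr, float_hcomp in G by reflexivity.
  transitivity ((⌊iotaV U B⌋ ⊗ ⟨m1 U f⟩) ⋅ ⌊gammaV U (id1 B) f⌋ ⋅
    (⌊gamma U (id1 B) f⌋ ⋅ (⌊iota U B⌋ ⊗ ⟨m1 U f⟩))).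
  - rewrite G, fvcomp_idr; [reflexivity | boundary].
  - rewrite fvcompA, (fvcomp_at (gammaV_gamma _ _)), fvcomp_idr by reflexivity.
    rewrite <- fwhisker_r, iotaV_iota by reflexivity.
    apply fhcomp_idl.
Qed.

Lemma gammaV_unitr (A B : C) (f : hom A B) :
  (⟨m1 U f⟩ ⊗ ⌊iotaV U A⌋) ⋅ ⌊gammaV U f (id1 A)⌋ = ⟨m1 U f⟩.
Proof.
  pose proof (f_equal (fun s => ⌊s⌋) (gamma_unitr (pseudo_colax (plaws U)) f)) as G.
  cbv beta in G.
  rewrite !float_vcomp in G; unfold runit in G.
  rewrite float_eqc, float_m2_eqc, fvcomp_idr, float_hcomp in G by reflexivity.
  transitivity ((⟨m1 U f⟩ ⊗ ⌊iotaV U A⌋) ⋅ ⌊gammaV U f (id1 A)⌋ ⋅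
    (⌊gamma U f (id1 A)⌋ ⋅ (⟨m1 U f⟩ ⊗ ⌊iota U A⌋))).
  - rewrite G, fvcomp_idr; [reflexivity | boundary].
  - rewrite fvcompA, (fvcomp_at (gammaV_gamma _ _)), fvcomp_idr by reflexivity.
    rewrite <- fwhisker_l, iotaV_iota by reflexivity.
    apply fhcomp_idr.
Qed.

(** The axioms for transformations and modifications into a composite with [U] end in
    [gamma]; the universal property needs [gammaV] on the other side. *)
Lemma gamma_transpose (A : D) (A' B X : C) (g : hom B X) (f : hom A' B) (p : hom A (U A'))
  (x z : fcell A (U X)) :
  tgt x = m1 U (g ∘ f) ∘ p -> tgt z = m1 U g ∘ m1 U f ∘ p ->
  x ⋅ (⌊gamma U g f⌋ ⊗ ⟨p⟩) = z <-> x = z ⋅ (⌊gammaV U g f⌋ ⊗ ⟨p⟩).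
Proof.
  intros ex ez; split; [intros <- | intros ->].
  - rewrite <- fvcompA, <- fwhisker_r, gamma_gammaV by reflexivity.
    rewrite <- float_id_comp, fvcomp_idr; [reflexivity | now symmetry].
  - rewrite <- fvcompA, <- fwhisker_r, gammaV_gamma by reflexivity.
    rewrite <- float_id_comp, fvcomp_idr; [reflexivity | now symmetry].
Qed.

Lemma iota_transpose (A : D) (A' : C) (p : hom A (U A')) (x z : fcell A (U A')) :
  tgt x = m1 U (id1 A') ∘ p -> tgt z = p ->
  x ⋅ (⌊iota U A'⌋ ⊗ ⟨p⟩) = z <-> x = z ⋅ (⌊iotaV U A'⌋ ⊗ ⟨p⟩).
Proof.
  intros ex ez; split; [intros <- | intros ->].
  - rewrite <- fvcompA, <- fwhisker_r, iota_iotaV by reflexivity.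
    rewrite <- float_id_comp, fvcomp_idr; [reflexivity | now symmetry].
  - rewrite <- fvcompA, <- fwhisker_r, iotaV_iota by reflexivity.
    rewrite fhcomp_idl, fvcomp_idr; [reflexivity | now symmetry].
Qed.

Lemma act_vcomp {A : D} {A' B : C} (p : hom A (U A'))
  (x : fcell A (U B)) (a b : fcell A' B) : tgt a = src b ->
  x ⋄[p] (a ⋅ b) = x ⋅ (fmap U a ⊗ ⟨p⟩) ⋅ (fmap U b ⊗ ⟨p⟩).
Proof.
  intro e; rewrite fmap_vcomp, fwhisker_r, fvcompA; [reflexivity| |exact e].
  cbn; now rewrite e.
Qed.

Lemma act_id {A : D} {A' B : C} (p : hom A (U A'))
  (x : fcell A (U B)) (g : hom A' B) : tgt x = m1 U g ∘ p -> x ⋄[p] ⟨g⟩ = x.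
Proof.
  intro e; rewrite fmap_id, <- float_id_comp; apply fvcomp_idr; now symmetry.
Qed.

End PseudofunctorLaws.

(** * Pasting of squares *)

(** The horizontal pasting of the square [t], with upper side [f], left side [p] and lower
    side [v], and the square [x], with lower side [u].  As for composition, the square that
    comes first geometrically is written last.  The right side of [t] is the left side
    of [x]; it occurs only in the boundaries of [x] and [t]. *)
Definition paste {C D : twocat} (U : pseudofunctor C D) {A B : D} {A' B' X : C}
  (u : hom B' X) (v : hom A' B') (f : hom A B)
  (p : hom A (U A')) (x : fcell B (U X)) (t : fcell A (U B')) : fcell A (U X) :=
  (x ⊗ ⟨f⟩) ⋅ (⟨m1 U u⟩ ⊗ t) ⋅ (⌊gammaV U u v⌋ ⊗ ⟨p⟩).

Ltac boundary ::=
  cbn [src tgt float fvcomp fhcomp fmap paste];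
  rewrite <- ?comp_assoc, ?comp_id1l, ?comp_id1r in *;
  repeat match goal with
  | H : src _ = _ |- _ => rewrite H
  | H : tgt _ = _ |- _ => rewrite H
  end;
  rewrite <- ?comp_assoc, ?comp_id1l, ?comp_id1r;
  reflexivity.

Section Pasting.
Context {C D : twocat} (U : pseudofunctor C D).

Lemma paste_postcomp {A B : D} {A' B' X' : C} (f : hom A B) (p : hom A (U A'))
  (q : hom B (U B')) (u u' : hom B' X') (v v' : hom A' B') (x : fcell B (U X'))
  (t : fcell A (U B')) (a : fcell B' X') (b : fcell A' B') :
  src a = u -> tgt a = u' -> src b = v -> tgt b = v' ->
  tgt x = m1 U u ∘ q -> src t = q ∘ f -> tgt t = m1 U v ∘ p ->
  paste u v f p x t ⋄[p] (a ⊗ b) = paste u' v' f p (x ⋄[q] a) (t ⋄[p] b).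
Proof.
  intros <- <- <- <- ex et et'; unfold paste.
  rewrite <- fvcompA, <- fwhisker_r by reflexivity.
  rewrite (gammaV_nat U (x := a) (y := b) eq_refl eq_refl eq_refl eq_refl).
  rewrite fwhisker_r, fvcompA by reflexivity; f_equal.
  rewrite fwhisker_r, <- !fvcompA by exact ex; f_equal.
  rewrite <- !fhcompA, <- float_id_comp.
  rewrite <- finterchange by (reflexivity || exact et').
  rewrite fvcomp_idl by reflexivity.
  rewrite fhcomp_rl by boundary; reflexivity.
Qed.

Lemma paste_precomp {A B : D} {A' B' X' : C} (f : hom A B) (p : hom A (U A'))
  (q : hom B (U B')) (u : hom B' X') (v : hom A' B') (f' : hom A B) (x : fcell B (U X'))
  (t : fcell A (U B')) (a : fcell B (U X')) (b : fcell A B) :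
  src b = f' -> tgt b = f ->
  tgt a = src x -> tgt x = m1 U u ∘ q -> src t = q ∘ f ->
  (a ⊗ b) ⋅ paste u v f p x t = paste u v f' p (a ⋅ x) ((⟨q⟩ ⊗ b) ⋅ t).
Proof.
  intros <- <- ea ex et; unfold paste.
  rewrite !fvcompA; f_equal.
  rewrite <- finterchange by (reflexivity || exact ea).
  rewrite fvcomp_idr by reflexivity.
  rewrite fwhisker_l, fvcompA by boundary; f_equal.
  rewrite fhcompA, <- float_id_comp, fhcomp_rl by (reflexivity || boundary); reflexivity.
Qed.

Arguments paste_precomp {A B A' B' X' f p q u v f' x t a b} _ _ _ _ _.

Lemma paste_precomp_outer {A B : D} {A' B' X : C} (u : hom B' X)
  (v : hom A' B') (f : hom A B) (p : hom A (U A')) (a x : fcell B (U X)) (t : fcell A (U B')) :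
  tgt a = src x -> (a ⊗ ⟨f⟩) ⋅ paste u v f p x t = paste u v f p (a ⋅ x) t.
Proof. intros e; unfold paste; now rewrite fwhisker_r, !fvcompA. Qed.

(** The case of [paste_precomp] in which [x] has an identity as upper side, as [phi] does,
    so that a 2-cell on top of the pasting is one on top of [t]. *)
Lemma paste_precomp_inner {A : D} {A' B' X : C} (u : hom B' X)
  (v : hom A' B') (f f' : hom A (U X)) (p : hom A (U A')) (q : hom (U X) (U B'))
  (x : fcell (U X) (U X)) (t : fcell A (U B')) (b : fcell A (U X)) :
  src b = f' -> tgt b = f -> src x = id1 (U X) -> tgt x = m1 U u ∘ q -> src t = q ∘ f ->
  b ⋅ paste u v f p x t = paste u v f' p x ((⟨q⟩ ⊗ b) ⋅ t).
Proof.
  intros e1 e2 ex ex' et; rewrite <- (fhcomp_idl b) at 1.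
  rewrite (paste_precomp (q := q) e1 e2) by (assumption || now symmetry).
  now rewrite fvcomp_idl.
Qed.

(** Both sides contain the same three cells; what remains is to slide [z] past
    [gammaV U u v] and to use associativity of [gammaV]. *)
Lemma paste_assoc {A B X : D} {A' B' X' Y' : C} (u : hom X' Y') (v : hom B' X')
  (w : hom A' B') (f : hom B X) (g : hom A B) (o : hom A (U A')) (p : hom B (U B'))
  (q : hom X (U X')) (x : fcell X (U Y')) (t : fcell B (U X')) (z : fcell A (U B')) :
  tgt x = m1 U u ∘ q -> src t = q ∘ f -> tgt t = m1 U v ∘ p ->
  src z = p ∘ g -> tgt z = m1 U w ∘ o ->
  paste u (v ∘ w) (f ∘ g) o x (paste v w g o t z) =
  paste (u ∘ v) w g o (paste u v f p x t) z.
Proof.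
  intros ex et et' ez ez'; unfold paste.
  rewrite !fwhisker_l by boundary.
  rewrite !fwhisker_r by boundary.
  rewrite (float_id_comp f g), !fhcompA, <- !fvcompA; do 2 f_equal.
  rewrite <- (fhcompA _ ⟨p⟩), <- float_id_comp.
  rewrite <- (float_id_comp p g), (fvcompA _ (⟨m1 U (u ∘ v)⟩ ⊗ z)).
  rewrite (fhcomp_rl (x := ⌊gammaV U u v⌋)) by (boundary || reflexivity).
  rewrite <- (fhcomp_lr (x := ⌊gammaV U u v⌋) (y := z) eq_refl eq_refl), ez'.
  rewrite (float_id_comp _ o), (fhcompA ⌊gammaV U u v⌋), <- fvcompA; f_equal.
  now rewrite <- !fwhisker_r, gammaV_assoc by boundary.
Qed.

Lemma paste_unitr {A : D} {B' X' : C} (u : hom B' X') (p : hom A (U B'))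
  (x : fcell A (U X')) : tgt x = m1 U u ∘ p ->
  paste u (id1 B') (id1 A) p x (⌊iotaV U B'⌋ ⊗ ⟨p⟩) = x.
Proof.
  intros ex; unfold paste.
  rewrite fhcomp_idr, fhcompA, <- fvcompA, <- fwhisker_r, gammaV_unitr by boundary.
  rewrite <- float_id_comp; apply fvcomp_idr; now symmetry.
Qed.

Lemma paste_unitl {A B : D} {A' X' : C} (v : hom A' X') (f : hom A B) (p : hom A (U A'))
  (q : hom B (U X')) (t : fcell A (U X')) :
  src t = q ∘ f -> tgt t = m1 U v ∘ p ->
  paste (id1 X') v f p (⌊iotaV U X'⌋ ⊗ ⟨q⟩) t = t.
Proof.
  intros et et'; unfold paste.
  rewrite <- fhcompA, <- float_id_comp, fhcomp_rl by boundary.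
  rewrite <- (fhcomp_lr (x := ⌊iotaV U X'⌋) (y := t) eq_refl eq_refl), et'; cbn [src float].
  rewrite fhcomp_idl, float_id_comp, fhcompA, <- fvcompA, <- fwhisker_r, gammaV_unitl by boundary.
  rewrite <- float_id_comp; apply fvcomp_idr; now symmetry.
Qed.

(** Pasting with the identity square on [h], whose vertical sides are identities. *)
Lemma paste_id (A : D) (A' B X : C) (h : hom B X)
  (u : hom A' B) (f : hom A (U B)) (p : hom A (U A')) (t : fcell A (U B)) : src t = f ->
  paste h u f p ⟨m1 U h⟩ t = (⟨m1 U h⟩ ⊗ t) ⋅ (⌊gammaV U h u⌋ ⊗ ⟨p⟩).
Proof. intros <-; unfold paste; now rewrite <- float_id_comp, fvcomp_idl. Qed.

Lemma float_paste_ext (A B : D) (FA FB Z : C)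
  (yA : hom A (U FA)) (yB : hom B (U FB))
  (k : hom B (U Z)) (f : hom A B) (u : hom FB Z) (v : hom FA FB)
  (s : k ⇒ m1 U u ∘ yB) (t : yB ∘ f ⇒ m1 U v ∘ yA) :
  ⌊paste_ext s t⌋ = paste u v f yA ⌊s⌋ ⌊t⌋.
Proof.
  unfold paste_ext, paste, assoc, assocV; rewrite !float_vcomp, !float_eqc.
  rewrite !fvcomp_idr by boundary; reflexivity.
Qed.

End Pasting.

Arguments paste_precomp_inner {C D U A A' B' X u v f f' p q x t b} _ _ _ _ _.

(** * The universal property of U-extensions *)

(* Since [is_Uext] unfolds to a product, the default implicit arguments of these two
   projections go past their statements. *)
Arguments dext_Uext {C D U F0 y} c {A B} f g a : rename.
Arguments dext_coherent {C D U F0 y} c {X Y} f g a : rename.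

Section Fill.
Context {C D : twocat} {U : pseudofunctor C D}.
Context {A : D} {FA B : C} {yA : hom A (U FA)} {f : hom A (U B)} {f' : hom FA B}
  {psi : f ⇒ m1 U f' ∘ yA}.
Hypothesis ext : is_Uext psi.

Definition fill (g : hom FA B) (a : f ⇒ m1 U g ∘ yA) : f' ⇒ g :=
  proj1_sig (constructive_indefinite_description _ (ext a)).

Lemma fill_eq (g : hom FA B) (a : f ⇒ m1 U g ∘ yA) :
  ⌊psi⌋ ⋄[yA] ⌊fill a⌋ = ⌊a⌋.
Proof.
  unfold fill; destruct constructive_indefinite_description as [t [E u]]; cbn [proj1_sig].
  clear u.
  rewrite <- E, float_vcomp; reflexivity.
Qed.

Lemma Uext_inj (g : hom FA B) (s t : f' ⇒ g) :
  ⌊psi⌋ ⋄[yA] ⌊s⌋ = ⌊psi⌋ ⋄[yA] ⌊t⌋ -> s = t.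
Proof.
  intro E; destruct (ext (psi ;; (m2 U t ▷ yA))) as [r [_ uni]].
  transitivity r; [symmetry|]; apply uni; [|reflexivity].
  apply float_inj; rewrite !float_vcomp; exact E.
Qed.

End Fill.

Lemma Uext_inverse {C D : twocat} (U : pseudofunctor C D) {A : D} {FA B : C}
  {yA : hom A (U FA)} {f : hom A (U B)} {f' f'' : hom FA B}
  (psi : f ⇒ m1 U f' ∘ yA) (psi' : f ⇒ m1 U f'' ∘ yA) (E : is_Uext psi) (E' : is_Uext psi') :
  is_inverse (fill E psi') (fill E' psi).
Proof.
  split.
  - apply (Uext_inj E); rewrite float_vcomp, act_vcomp, !fill_eq by reflexivity.
    symmetry; apply act_id; reflexivity.
  - apply (Uext_inj E'); rewrite float_vcomp, act_vcomp, !fill_eq by reflexivity.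
    symmetry; apply act_id; reflexivity.
Qed.

(** * The data induced by the universal property *)

(** The chosen extensions enter the argument through their universal properties alone, so
    [F], [eps], [d] and [phi] are variables from here on. *)
Section Data.
Context {C D : twocat} {U : pseudofunctor C D} {F : map1 D C}.
Context {y : forall A : D, hom A (U (F A))}.
Variable d : forall (A B : D) (f : hom A B), y B ∘ f ⇒ m1 U (m1 F f) ∘ y A.
Context {eps : forall B : C, hom (F (U B)) B}.
Variable phi : forall B : C, id1 (U B) ⇒ m1 U (eps B) ∘ y (U B).
Arguments d {A B} f.

Hypothesis d_ext : forall (A B : D) (f : hom A B), is_Uext (d f).
Hypothesis coherent : forall (X : D) (Y : C) (f : hom X (U Y)),
  is_Uext (lunitV f ;; paste_ext (phi Y) (d f)).
Arguments d_ext {A B} f g a.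
Arguments coherent {X Y} f g a.

Local Notation eta := (@Trans D D (map1_id D) (map1_comp U F) y (@d)).
Local Notation counit_squares := (forall (B B' : C) (h : hom B B'),
  eps B' ∘ m1 F (m1 U h) ⇒ h ∘ eps B).
Local Notation counit e := (@Trans C C (map1_comp F U) (map1_id C) eps e).

(** The three transposition equations that determine a colax structure on [F]. *)
Definition unit_eqs (S : colax_str F) : Prop :=
  (forall (A B : D) (f g : hom A B) (s : f ⇒ g),
     ⌊d f⌋ ⋄[y A] ⌊str2 S s⌋ = (⟨y B⟩ ⊗ ⌊s⌋) ⋅ ⌊d g⌋) /\
  (forall (A B X : D) (g : hom B X) (f : hom A B),
     ⌊d (g ∘ f)⌋ ⋄[y A] ⌊str_gamma S g f⌋ = paste (m1 F g) (m1 F f) f (y A) ⌊d g⌋ ⌊d f⌋) /\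
  (forall A : D, ⌊d (id1 A)⌋ ⋄[y A] ⌊str_iota S A⌋ = ⌊iotaV U (F A)⌋ ⊗ ⟨y A⟩).

Definition counit_eqs (e : counit_squares) : Prop :=
  forall (B B' : C) (h : hom B B'),
    paste (eps B') (m1 F (m1 U h)) (m1 U h) (y (U B)) ⌊phi B'⌋ ⌊d (m1 U h)⌋
      ⋄[y (U B)] ⌊e B B' h⌋ =
    paste h (eps B) (id1 (U B)) (y (U B)) ⟨m1 U h⟩ ⌊phi B⌋.

Lemma exists_colax_str : exists S : colax_str F, unit_eqs S.
Proof.
  unshelve eexists.
  - unshelve refine (@ColaxStr D C F _ _ _).
    + intros A B f g s.
      exact (fill (d_ext f) ((y B ◁ s) ;; d g)).
    + intros A B X g f.
      exact (fill (d_ext (g ∘ f))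
        (assoc (y X) g f ;; paste_ext (d g) (d f))).
    + intros A.
      exact (fill (d_ext (id1 A))
        (runit (y A) ;; (lunitV (y A) ;; (iotaV U (F A) ▷ y A)))).
  - split; [|split].
    + intros A B f g s.
      etransitivity; [apply (fill_eq (d_ext f))|apply float_vcomp].
    + intros A B X g f.
      etransitivity; [apply (fill_eq (d_ext (g ∘ f)))|].
      rewrite float_vcomp, float_paste_ext; unfold assoc; rewrite float_eqc.
      apply fvcomp_idl; boundary.
    + intros A.
      etransitivity; [apply (fill_eq (d_ext (id1 A)))|].
      rewrite !float_vcomp; unfold runit, lunitV; rewrite !float_eqc.
      rewrite !fvcomp_idl by boundary; reflexivity.
Qed.

Lemma coherent_paste (X : D) (Y : C) (f : hom X (U Y)) :
  ⌊lunitV f ;; paste_ext (phi Y) (d f)⌋ =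
  paste (eps Y) (m1 F f) f (y X) ⌊phi Y⌋ ⌊d f⌋.
Proof.
  rewrite float_vcomp, float_paste_ext; unfold lunitV; rewrite float_eqc.
  apply fvcomp_idl; boundary.
Qed.

(** Coherent closure provides the U-extension along which the modification axiom is solved. *)
Lemma exists_counit : exists e : counit_squares, counit_eqs e.
Proof.
  unshelve eexists.
  - intros B B' h.
    refine (fill (coherent (m1 U h))
      (runitV (m1 U h) ;; (m1 U h ◁ phi B) ;; assoc _ _ _ ;;
       (gammaV U h (eps B) ▷ y (U B)))).
  - intros B B' h.
    etransitivity; [|etransitivity; [apply (fill_eq (coherent (m1 U h)))|]].
    + now rewrite coherent_paste.
    + unfold runitV, assoc, paste; rewrite !float_vcomp, !float_eqc.
      rewrite (fvcomp_idl (f := m1 U h)), (fvcomp_idr (f := m1 U h ∘ _)) by boundary.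
      rewrite fhcomp_idr, fvcomp_idl by boundary. reflexivity.
Qed.

(** The two differ by moving the structure cells of [U] across the equations. *)
Lemma natural_unit_eqs (S : colax_str F) :
  is_colax_nat (functor_id D) (functor_comp U (ColaxData S)) eta <-> unit_eqs S.
Proof.
  assert (E1 : forall (A B : D) (f g : hom A B) (s : f ⇒ g),
    (y B ◁ s) ;; d g = d f ;; (m2 U (str2 S s) ▷ y A) <->
    ⌊d f⌋ ⋄[y A] ⌊str2 S s⌋ = (⟨y B⟩ ⊗ ⌊s⌋) ⋅ ⌊d g⌋).
  { intros; rewrite <- float_iff, !float_vcomp; split; intro E; symmetry; exact E. }
  assert (E2 : forall (A B X : D) (g : hom B X) (f : hom A B),
    d (g ∘ f) ;; ((m2 U (str_gamma S g f) ;; gamma U (m1 F g) (m1 F f)) ▷ y A) =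
    (y X ◁ id2 (g ∘ f)) ;; assoc (y X) g f ;; (d g ▷ f) ;; assocV (m1 U (m1 F g)) (y B) f
      ;; (m1 U (m1 F g) ◁ d f) ;; assoc (m1 U (m1 F g)) (m1 U (m1 F f)) (y A) <->
    ⌊d (g ∘ f)⌋ ⋄[y A] ⌊str_gamma S g f⌋ = paste (m1 F g) (m1 F f) f (y A) ⌊d g⌋ ⌊d f⌋).
  { intros A B X g f; rewrite <- float_iff; unfold assoc, assocV.
    rewrite !float_vcomp_eqc, !float_vcomp, !float_eqc, !float_hcomp, float_vcomp.
    rewrite <- (float_id_comp (y X)), fvcomp_idl, fvcomp_idl, fvcomp_idr by boundary.
    rewrite fwhisker_r, fvcompA by reflexivity; apply gamma_transpose; boundary. }
  assert (E3 : forall A : D,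
    d (id1 A) ;; ((m2 U (str_iota S A) ;; iota U (F A)) ▷ y A) ;; lunit (y A) =
    (y A ◁ id2 (id1 A)) ;; runit (y A) <->
    ⌊d (id1 A)⌋ ⋄[y A] ⌊str_iota S A⌋ = ⌊iotaV U (F A)⌋ ⊗ ⟨y A⟩).
  { intros A; rewrite <- float_iff; unfold lunit, runit.
    rewrite !float_vcomp_eqc, !float_vcomp, !float_hcomp, float_vcomp, fhcomp_idr.
    rewrite fwhisker_r, fvcompA by reflexivity.
    rewrite <- (fvcomp_idl (f := y A) (x := ⌊iotaV U (F A)⌋ ⊗ ⟨y A⟩)) by boundary.
    apply iota_transpose; boundary. }
  split.
  - intros [N1 N2 N3]; split; [|split].
    + intros A B f g s; exact (proj1 (E1 A B f g s) (N1 A B f g s)).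
    + intros A B X g f; exact (proj1 (E2 A B X g f) (N2 A B X g f)).
    + intros A; exact (proj1 (E3 A) (N3 A)).
  - intros [N1 [N2 N3]]; split.
    + intros A B f g s; exact (proj2 (E1 A B f g s) (N1 A B f g s)).
    + intros A B X g f; exact (proj2 (E2 A B X g f) (N2 A B X g f)).
    + intros A; exact (proj2 (E3 A) (N3 A)).
Qed.

(** After floating, the composite [U eps ∘ y U] evaluated at [h] is the pasting of [phi] with
    [d (U h)], followed by [e h] and by [gamma]. *)
Lemma modification_counit_eqs (e : counit_squares) :
  is_modification (trans_id U) (U_eps_eta (counit e) eta) phi <->
  counit_eqs e.
Proof.
  assert (R : forall (B B' : C) (h : hom B B'),
    ⌊(phi B' ▷ m1 U h) ;; tsq (U_eps_eta (counit e) eta) h⌋ =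
    paste (eps B') (m1 F (m1 U h)) (m1 U h) (y (U B)) ⌊phi B'⌋ ⌊d (m1 U h)⌋
      ⋄[y (U B)] ⌊e B B' h⌋ ⋅ (⌊gamma U h (eps B)⌋ ⊗ ⟨y (U B)⟩)).
  { intros B B' h; unfold U_eps_eta, trans_comp, trans_post, trans_pre, assoc, assocV.
    cbn [tsq tc].
    rewrite !float_vcomp, !float_eqc, !float_hcomp, !float_vcomp.
    change (⌊phi B'⌋ ⊗ ⟨m1 U h⟩ ⋅ (⟨m1 U (eps B') ∘ y (U B') ∘ m1 U h⟩ ⋅
     (⟨m1 U (eps B')⟩ ⊗ ⌊d (m1 U h)⌋) ⋅
     ⟨m1 U (eps B') ∘ (m1 U (m1 F (m1 U h)) ∘ y (U B))⟩ ⋅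
     ((⌊gammaV U (eps B') (m1 F (m1 U h))⌋ ⋅ ⌊m2 U (e B B' h)⌋ ⋅ ⌊gamma U h (eps B)⌋)
       ⊗ ⟨y (U B)⟩) ⋅ ⟨m1 U h ∘ m1 U (eps B) ∘ y (U B)⟩) =
     paste (eps B') (m1 F (m1 U h)) (m1 U h) (y (U B)) ⌊phi B'⌋ ⌊d (m1 U h)⌋
      ⋄[y (U B)] ⌊e B B' h⌋ ⋅ (⌊gamma U h (eps B)⌋ ⊗ ⟨y (U B)⟩)).
    rewrite fvcomp_idl, !fvcomp_idr by boundary.
    unfold paste; rewrite !fwhisker_r, !fvcompA by boundary; reflexivity. }
  assert (L : forall (B B' : C) (h : hom B B'),
    ⌊tsq (trans_id U) h ;; (m1 U h ◁ phi B)⌋ = ⟨m1 U h⟩ ⊗ ⌊phi B⌋).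
  { intros B B' h; unfold trans_id, lunit, runitV; cbn [tsq tc].
    rewrite !float_vcomp, !float_eqc, fvcomp_idl, fvcomp_idl by boundary; reflexivity. }
  assert (T : forall (B B' : C) (h : hom B B'),
    tsq (trans_id U) h ;; (m1 U h ◁ phi B) =
    (phi B' ▷ m1 U h) ;; tsq (U_eps_eta (counit e) eta) h <->
    paste (eps B') (m1 F (m1 U h)) (m1 U h) (y (U B)) ⌊phi B'⌋ ⌊d (m1 U h)⌋
      ⋄[y (U B)] ⌊e B B' h⌋ =
    paste h (eps B) (id1 (U B)) (y (U B)) ⟨m1 U h⟩ ⌊phi B⌋).
  { intros B B' h; rewrite <- float_iff, paste_id, L by reflexivity.
    etransitivity; [|apply gamma_transpose; boundary].
    rewrite <- R; split; intro E; symmetry; exact E. }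
  split; intros M B B' h; apply T, M.
Qed.

Lemma ext_inj (A B : D) (f : hom A B) (g : hom (F A) (F B)) (s t : m1 F f ⇒ g) :
  ⌊d f⌋ ⋄[y A] ⌊s⌋ = ⌊d f⌋ ⋄[y A] ⌊t⌋ -> s = t.
Proof. apply (Uext_inj (d_ext f)). Qed.

Lemma coherent_inj (X : D) (Y : C) (f : hom X (U Y)) (g : hom (F X) Y)
  (s t : eps Y ∘ m1 F f ⇒ g) :
  paste (eps Y) (m1 F f) f (y X) ⌊phi Y⌋ ⌊d f⌋ ⋄[y X] ⌊s⌋ =
  paste (eps Y) (m1 F f) f (y X) ⌊phi Y⌋ ⌊d f⌋ ⋄[y X] ⌊t⌋ -> s = t.
Proof.
  rewrite <- !coherent_paste; apply (Uext_inj (coherent f)).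
Qed.

Lemma unit_eqs_unique (S S' : colax_str F) : unit_eqs S -> unit_eqs S' -> S' = S.
Proof.
  destruct S as [a b c], S' as [a' b' c']; intros [E1 [E2 E3]] [E1' [E2' E3']].
  cbn [str2 str_gamma str_iota] in *; f_equal.
  - do 5 (apply functional_extensionality_dep; intro).
    apply ext_inj; now rewrite E1, E1'.
  - do 5 (apply functional_extensionality_dep; intro).
    apply ext_inj; now rewrite E2, E2'.
  - apply functional_extensionality_dep; intro.
    apply ext_inj; now rewrite E3, E3'.
Qed.

Lemma counit_eqs_unique (e e' : counit_squares) :
  counit_eqs e -> counit_eqs e' -> e' = e.
Proof.
  intros E E'; do 3 (apply functional_extensionality_dep; intro).
  apply coherent_inj; now rewrite E, E'.
Qed.

(** * The colax functor and the counit *)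

Section Laws.
Variable S : colax_str F.
Hypothesis unitS : unit_eqs S.
Local Notation FS := (ColaxData S).

Lemma d_m2 {A B : D} {f g : hom A B} (s : f ⇒ g) :
  ⌊d f⌋ ⋄[y A] ⌊m2 FS s⌋ = (⟨y B⟩ ⊗ ⌊s⌋) ⋅ ⌊d g⌋.
Proof. apply unitS. Qed.

Lemma d_gamma {A B X : D} (g : hom B X) (f : hom A B) :
  ⌊d (g ∘ f)⌋ ⋄[y A] ⌊gamma FS g f⌋ = paste (m1 F g) (m1 F f) f (y A) ⌊d g⌋ ⌊d f⌋.
Proof. apply unitS. Qed.

Lemma d_iota (A : D) :
  ⌊d (id1 A)⌋ ⋄[y A] ⌊iota FS A⌋ = ⌊iotaV U (F A)⌋ ⊗ ⟨y A⟩.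
Proof. apply unitS. Qed.

Lemma d_m2_eqc {A B : D} {f g : hom A B} (e : f = g) :
  ⌊d f⌋ ⋄[y A] ⌊m2 FS (eqc e)⌋ = ⌊d g⌋.
Proof.
  rewrite d_m2, float_eqc, <- float_id_comp.
  apply fvcomp_idl; cbn; now rewrite e.
Qed.

(** On transposes, each axiom is a law of [paste]: naturality of [gamma] becomes naturality of
    pasting, associativity becomes [paste_assoc], and the unit axioms become [paste_unitl]
    and [paste_unitr]. *)
Lemma colax_functor_FS : is_colax_functor FS.
Proof.
  split.
  - intros A B f; apply ext_inj; rewrite act_id by reflexivity.
    exact (d_m2_eqc (eq_refl f)).
  - intros A B f g h s t; apply ext_inj.
    rewrite float_vcomp, act_vcomp, !d_m2 by reflexivity.
    rewrite <- fvcompA, d_m2, float_vcomp, fwhisker_l, fvcompA by reflexivity; reflexivity.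
  - intros A B X g g' f f' t s; apply ext_inj.
    rewrite !float_vcomp, !act_vcomp, d_m2, d_gamma by reflexivity.
    rewrite <- fvcompA, d_gamma, !float_hcomp.
    rewrite (paste_postcomp (q := y B) (u' := m1 F g') (v' := m1 F f')) by reflexivity.
    rewrite !d_m2, fhcompA; apply paste_precomp; reflexivity.
  - intros A B X Y h g f; apply ext_inj; unfold assoc; rewrite float_vcomp_eqc.
    rewrite !float_vcomp, !act_vcomp, d_m2_eqc, !d_gamma, !float_hcomp by reflexivity.
    rewrite (paste_postcomp (q := y X) (u' := m1 F h) (v' := m1 F g ∘ m1 F f)),
      (paste_postcomp (q := y B) (u' := m1 F h ∘ m1 F g) (v' := m1 F f)) by reflexivity.
    rewrite !act_id, !d_gamma by reflexivity.
    apply (paste_assoc (p := y B) (q := y X)); reflexivity.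
  - intros A B f; apply ext_inj; unfold lunit; rewrite float_vcomp_eqc, d_m2_eqc.
    rewrite float_vcomp, act_vcomp, d_gamma, float_hcomp by reflexivity.
    rewrite (paste_postcomp (q := y B) (u' := id1 (F B)) (v' := m1 F f)) by reflexivity.
    rewrite act_id, d_iota by reflexivity; apply paste_unitl; reflexivity.
  - intros A B f; apply ext_inj; unfold runit; rewrite float_vcomp_eqc, d_m2_eqc.
    rewrite float_vcomp, act_vcomp, d_gamma, float_hcomp by reflexivity.
    rewrite (paste_postcomp (q := y A) (v' := id1 (F A)) (u' := m1 F f)) by reflexivity.
    rewrite act_id, d_iota by reflexivity; apply paste_unitr; reflexivity.
Qed.

Variable e : counit_squares.
Arguments e {B B'} h.
Hypothesis counit_e : counit_eqs (@e).

Lemma counit_e_eq {B B' : C} (h : hom B B') :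
  paste (eps B') (m1 F (m1 U h)) (m1 U h) (y (U B)) ⌊phi B'⌋ ⌊d (m1 U h)⌋
      ⋄[y (U B)] ⌊e h⌋ =
    paste h (eps B) (id1 (U B)) (y (U B)) ⟨m1 U h⟩ ⌊phi B⌋.
Proof. apply counit_e. Qed.

(** On transposes along the pasting of [phi] with [d (U h)], the squares [e h] replace
    [phi, d (U h)] by [U h, phi], where [U h] is the identity square on [h]; the axioms say
    that moving [phi] in this way is compatible with 2-cells, composites and identities. *)
Lemma colax_nat_counit : is_colax_nat (functor_comp FS U) (functor_id C) (counit (@e)).
Proof.
  split; cbn [tc tsq].
  - intros B B' h k s; apply coherent_inj.
    change (paste (eps B') (m1 F (m1 U h)) (m1 U h) (y (U B)) ⌊phi B'⌋ ⌊d (m1 U h)⌋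
        ⋄[y (U B)] ⌊(eps B' ◁ m2 FS (m2 U s)) ;; e k⌋ =
      paste (eps B') (m1 F (m1 U h)) (m1 U h) (y (U B)) ⌊phi B'⌋ ⌊d (m1 U h)⌋
        ⋄[y (U B)] ⌊e h ;; (s ▷ eps B)⌋).
    rewrite !float_vcomp, !act_vcomp, !float_hcomp, counit_e_eq by reflexivity.
    rewrite (paste_postcomp (q := y (U B')) (u' := eps B') (v' := m1 F (m1 U k))) by reflexivity.
    rewrite act_id, d_m2, <- (paste_precomp_inner (f := m1 U k)), <- fvcompA, counit_e_eq by reflexivity.
    rewrite (paste_postcomp (q := id1 (U B)) (u' := k) (v' := eps B)) by boundary.
    rewrite act_id, fhcomp_idr, fvcomp_idl by reflexivity.
    change (fmap U ⌊s⌋) with ⌊m2 U s⌋.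
    rewrite <- (fhcomp_idr ⌊m2 U s⌋) at 1; rewrite paste_precomp_outer, fvcomp_idr; reflexivity.
  - intros A B X g f; apply coherent_inj; unfold assoc, assocV; rewrite !float_vcomp_eqc.
    change (paste (eps X) (m1 F (m1 U (g ∘ f))) (m1 U (g ∘ f)) (y (U A)) ⌊phi X⌋
        ⌊d (m1 U (g ∘ f))⌋ ⋄[y (U A)] ⌊e (g ∘ f) ;; (id2 (g ∘ f) ▷ eps A)⌋ =
      paste (eps X) (m1 F (m1 U (g ∘ f))) (m1 U (g ∘ f)) (y (U A)) ⌊phi X⌋
        ⌊d (m1 U (g ∘ f))⌋ ⋄[y (U A)]
        ⌊(eps X ◁ (m2 FS (gamma U g f) ;; gamma FS (m1 U g) (m1 U f))) ;;
          eqc (comp_assoc (eps X) (m1 F (m1 U g)) (m1 F (m1 U f))) ;;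
          (e g ▷ m1 F (m1 U f)) ;;
          eqc (eq_sym (comp_assoc g (eps B) (m1 F (m1 U f)))) ;; (g ◁ e f)⌋).
    rewrite !float_vcomp, !float_eqc, !float_hcomp, <- float_id_comp.
    rewrite !fvcomp_idr by boundary.
    rewrite float_vcomp, !act_vcomp, counit_e_eq by boundary.
    rewrite (paste_postcomp (q := y (U X)) (u' := eps X)
      (v' := m1 F (m1 U g) ∘ m1 F (m1 U f))) by reflexivity.
    rewrite act_id, act_vcomp, d_m2, <- (fvcompA (⟨_⟩ ⊗ ⌊gamma U g f⌋)), d_gamma by reflexivity.
    rewrite <- (paste_precomp_inner (f := m1 U g ∘ m1 U f)) by boundary.
    (* The pasting [phi, d (U g), d (U f)] has to become [U g, U f, phi]: first [e g] moves
       [phi] past [d (U g)], then [e f] moves it past [d (U f)]. *)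
    rewrite (paste_assoc (p := y (U B)) (q := y (U X))) by boundary.
    rewrite <- !fvcompA, (fvcompA (paste _ _ _ _ _ _)).
    rewrite (paste_postcomp (q := y (U B)) (u' := g ∘ eps B) (v' := m1 F (m1 U f))) by boundary.
    rewrite act_id, counit_e_eq by reflexivity.
    rewrite <- (paste_assoc (q := id1 (U B))), comp_id1l by boundary.
    rewrite (paste_postcomp (q := id1 (U B)) (u' := g) (v' := f ∘ eps A)) by boundary.
    rewrite counit_e_eq, act_id by boundary.
    (* The upper side [U f] of the pasting of the last two squares is to be read as
       [U f ∘ 1]. *)
    pose proof (paste_assoc (U := U) (u := g) (v := f) (w := eps A) (f := m1 U f)
      (g := id1 (U A)) (o := y (U A)) (p := id1 (U A)) (q := id1 (U B)) (x := ⟨m1 U g⟩)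
      (t := ⟨m1 U f⟩) (z := ⌊phi A⌋)) as E.
    rewrite (comp_id1r (m1 U f)) in E; rewrite E by boundary; clear E.
    rewrite (paste_id g f (f := m1 U f) (id1 (U A)) (t := ⟨m1 U f⟩) eq_refl).
    rewrite <- float_id_comp, fhcomp_idr, fvcomp_idl by boundary.
    rewrite <- (fhcomp_idr ⌊gamma U g f⌋), paste_precomp_outer, gamma_gammaV; reflexivity.
  - intros A; apply coherent_inj; unfold lunit, runit; rewrite !float_vcomp_eqc.
    change (paste (eps A) (m1 F (m1 U (id1 A))) (m1 U (id1 A)) (y (U A)) ⌊phi A⌋
        ⌊d (m1 U (id1 A))⌋ ⋄[y (U A)] ⌊e (id1 A) ;; (id2 (id1 A) ▷ eps A)⌋ =
      paste (eps A) (m1 F (m1 U (id1 A))) (m1 U (id1 A)) (y (U A)) ⌊phi A⌋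
        ⌊d (m1 U (id1 A))⌋ ⋄[y (U A)] ⌊eps A ◁ (m2 FS (iota U A) ;; iota FS (U A))⌋).
    rewrite !float_vcomp, !float_hcomp, <- float_id_comp, float_vcomp.
    rewrite fvcomp_idr, counit_e_eq by boundary.
    rewrite (paste_postcomp (q := y (U A)) (u' := eps A) (v' := id1 (F (U A)))) by reflexivity.
    rewrite act_id, act_vcomp, d_m2, <- (fvcompA (⟨_⟩ ⊗ ⌊iota U A⌋)), d_iota by reflexivity.
    rewrite <- (paste_precomp_inner (f := id1 (U A))) by boundary.
    rewrite paste_unitr, <- iota_iotaV by reflexivity.
    rewrite <- paste_precomp_outer by reflexivity.
    rewrite fhcomp_idr; f_equal.
    rewrite <- (fhcomp_idr ⌊iotaV U A⌋); apply paste_unitl; boundary.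
Qed.

(** * Invertibility and the adjunction *)

Lemma float_unit_ext (A : D) :
  ⌊lunitV (y A) ;; (iotaV U (F A) ▷ y A)⌋ = ⌊iotaV U (F A)⌋ ⊗ ⟨y A⟩.
Proof.
  unfold lunitV; rewrite float_vcomp, float_eqc, float_hcomp; apply fvcomp_idl; boundary.
Qed.

(** The inverse of [gamma] is induced by the composition axiom and that of [iota] by the unit
    axiom; both composites have the transpose of an identity. *)
Lemma pseudofunctor_FS :
  (forall A : D, is_Uext (lunitV (y A) ;; (iotaV U (F A) ▷ y A))) ->
  (forall (A B X : D) (f : hom A B) (g : hom B X),
     is_Uext (assoc (y X) g f ;; paste_ext (d g) (d f))) ->
  is_pseudofunctor FS.
Proof.
  intros unit_ext comp_ext.
  assert (P : forall (A B X : D) (f : hom A B) (g : hom B X),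
    ⌊assoc (y X) g f ;; paste_ext (d g) (d f)⌋ =
    paste (m1 F g) (m1 F f) f (y A) ⌊d g⌋ ⌊d f⌋).
  { intros A B X f g; unfold assoc; rewrite float_vcomp, float_eqc, float_paste_ext.
    apply fvcomp_idl; boundary. }
  assert (ce : forall (A B X : D) (f : hom A B) (g : hom B X),
    exists t : m1 F g ∘ m1 F f ⇒ m1 F (g ∘ f),
      paste (m1 F g) (m1 F f) f (y A) ⌊d g⌋ ⌊d f⌋ ⋄[y A] ⌊t⌋ = ⌊d (g ∘ f)⌋).
  { intros A B X f g; exists (fill (comp_ext A B X f g) (d (g ∘ f))).
    rewrite <- P; apply fill_eq. }
  assert (ci : forall (A B X : D) (f : hom A B) (g : hom B X) h
    (s t : m1 F g ∘ m1 F f ⇒ h),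
      paste (m1 F g) (m1 F f) f (y A) ⌊d g⌋ ⌊d f⌋ ⋄[y A] ⌊s⌋ =
      paste (m1 F g) (m1 F f) f (y A) ⌊d g⌋ ⌊d f⌋ ⋄[y A] ⌊t⌋ -> s = t).
  { intros A B X f g h s t; rewrite <- P; apply (Uext_inj (comp_ext A B X f g)). }
  clear P comp_ext.
  refine (@IsPseudofunctor D C FS colax_functor_FS
    (fun A B X g f => proj1_sig (constructive_indefinite_description _ (ce A B X f g)))
    (fun A => fill (unit_ext A) (runitV (y A) ;; d (id1 A))) _ _).
  - intros A B X g f; destruct constructive_indefinite_description as [t E].
    cbn [proj1_sig]; split.
    + apply ext_inj; rewrite float_vcomp, act_vcomp, d_gamma, act_id by reflexivity.
      exact E.
    + apply ci; rewrite float_vcomp, act_vcomp by reflexivity.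
      etransitivity; [apply (f_equal (fun x => x ⋅ _)), E|].
      rewrite act_id by boundary; apply d_gamma.
  - intros A.
    pose proof (fill_eq (unit_ext A) (runitV (y A) ;; d (id1 A))) as E.
    rewrite float_unit_ext, float_vcomp in E; unfold runitV in E at 2.
    rewrite float_eqc, (fvcomp_idl (x := ⌊d (id1 A)⌋)) in E by boundary.
    split.
    + apply ext_inj; rewrite float_vcomp, act_vcomp, d_iota, act_id by reflexivity.
      exact E.
    + apply (Uext_inj (unit_ext A)).
      rewrite float_unit_ext, float_vcomp, act_vcomp by reflexivity.
      etransitivity; [apply (f_equal (fun x => x ⋅ _)), E|].
      rewrite act_id by boundary; apply d_iota.
Qed.

(** The comparison of the U-extension of [y A] given by coherent closure with the unit square;
    it is invertible as soon as the latter is a U-extension as well. *)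
Definition Psi (A : D) : eps (F A) ∘ m1 F (y A) ⇒ id1 (F A) :=
  fill (coherent (y A)) (lunitV (y A) ;; (iotaV U (F A) ▷ y A)).

Lemma Psi_eq (A : D) :
  paste (eps (F A)) (m1 F (y A)) (y A) (y A) ⌊phi (F A)⌋ ⌊d (y A)⌋ ⋄[y A] ⌊Psi A⌋ =
  ⌊iotaV U (F A)⌋ ⊗ ⟨y A⟩.
Proof.
  rewrite <- float_unit_ext, <- coherent_paste.
  apply (fill_eq (coherent (y A))).
Qed.

(** Both [e] and [Psi] move the counit: [e h] takes [phi B] past [d (U h)], where it becomes
    [phi (F A)] next to [d (y A)], and [Psi A] then contracts these two to the unit square,
    which the identity square on [h] absorbs.  Taking [h] to be [F f] gives the modification
    axiom for [Psi], and taking it to be [eps B] gives the second swallowtail identity. *)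
Lemma counit_collapse (A : D) (B : C) (h : hom (F A) B) :
  paste (eps B) (m1 F (m1 U h) ∘ m1 F (y A)) (m1 U h ∘ y A) (y A) ⌊phi B⌋
    (paste (m1 F (m1 U h)) (m1 F (y A)) (y A) (y A) ⌊d (m1 U h)⌋ ⌊d (y A)⌋)
    ⋅ (fmap U (⌊e h⌋ ⊗ ⟨m1 F (y A)⟩) ⊗ ⟨y A⟩) ⋅ (fmap U (⟨h⟩ ⊗ ⌊Psi A⌋) ⊗ ⟨y A⟩) =
  ⟨m1 U h ∘ y A⟩.
Proof.
  rewrite (paste_assoc (p := y (U (F A))) (q := y (U B))) by reflexivity.
  rewrite (paste_postcomp (q := y (U (F A))) (u' := h ∘ eps (F A)) (v' := m1 F (y A)))
    by boundary.
  rewrite act_id, counit_e_eq by reflexivity.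
  rewrite <- (paste_assoc (q := id1 (U (F A)))), comp_id1l by boundary.
  rewrite (paste_postcomp (q := id1 (U (F A))) (u' := h) (v' := id1 (F A))) by boundary.
  rewrite Psi_eq, act_id by boundary.
  rewrite paste_id, fhcompA, <- fwhisker_r, gammaV_unitr, <- float_id_comp by boundary.
  reflexivity.
Qed.

Section Adjunction.
Variable pF : is_pseudofunctor FS.
Local Notation PF := (Pseudofunctor pF).

(* The inverses typed over [F] itself, so that their boundaries match those of [gamma FS]. *)
Let gV {A B X : D} (g : hom B X) (f : hom A B) : m1 F g ∘ m1 F f ⇒ m1 F (g ∘ f) :=
  gammaV PF g f.
Let iV (A : D) : id1 (F A) ⇒ m1 F (id1 A) := iotaV PF A.

Let gV_gamma {A B X : D} (g : hom B X) (f : hom A B) :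
  ⌊gV g f⌋ ⋅ ⌊gamma FS g f⌋ = ⟨m1 F g ∘ m1 F f⟩.
Proof. exact (gammaV_gamma PF g f). Qed.

Let gamma_gV {A B X : D} (g : hom B X) (f : hom A B) :
  ⌊gamma FS g f⌋ ⋅ ⌊gV g f⌋ = ⟨m1 F (g ∘ f)⟩.
Proof. exact (gamma_gammaV PF g f). Qed.

Let iota_iV (A : D) : ⌊iota FS A⌋ ⋅ ⌊iV A⌋ = ⟨m1 F (id1 A)⟩.
Proof. exact (iota_iotaV PF A). Qed.

(** The invertible [gamma] transports the injectivity of transposition from
    [eps Y ∘ F (k ∘ f)] to [eps Y ∘ F k ∘ F f]. *)
Lemma coherent_inj_comp {A B : D} {Y : C} (k : hom B (U Y)) (f : hom A B) (g : hom (F A) Y)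
  (s t : eps Y ∘ m1 F k ∘ m1 F f ⇒ g) :
  paste (eps Y) (m1 F k ∘ m1 F f) (k ∘ f) (y A) ⌊phi Y⌋
    (paste (m1 F k) (m1 F f) f (y A) ⌊d k⌋ ⌊d f⌋) ⋄[y A] ⌊s⌋ =
  paste (eps Y) (m1 F k ∘ m1 F f) (k ∘ f) (y A) ⌊phi Y⌋
    (paste (m1 F k) (m1 F f) f (y A) ⌊d k⌋ ⌊d f⌋) ⋄[y A] ⌊t⌋ -> s = t.
Proof.
  intros E.
  assert (K : (eps Y ◁ gamma FS k f) ;; assoc (eps Y) (m1 F k) (m1 F f) ;; s =
    (eps Y ◁ gamma FS k f) ;; assoc (eps Y) (m1 F k) (m1 F f) ;; t).
  { apply coherent_inj; unfold assoc.
    rewrite !float_vcomp, !float_eqc, !fvcomp_idr by boundary.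
    rewrite !act_vcomp, !float_hcomp by boundary.
    rewrite (paste_postcomp (q := y (U Y)) (u' := eps Y) (v' := m1 F k ∘ m1 F f)) by reflexivity.
    rewrite act_id, d_gamma by reflexivity; exact E. }
  apply (f_equal (fun x => (⟨eps Y⟩ ⊗ ⌊gV k f⌋) ⋅ ⌊x⌋)) in K; cbv beta in K.
  unfold assoc in K; rewrite !float_vcomp, !float_eqc, !fvcomp_idr in K by boundary.
  rewrite !float_hcomp, !fvcompA, <- fwhisker_l in K by boundary.
  rewrite gV_gamma, <- float_id_comp, !fvcomp_idl in K by boundary.
  exact (float_inj K).
Qed.

Lemma paste_gV {A B X : D} (g : hom B X) (f : hom A B) :
  paste (m1 F g) (m1 F f) f (y A) ⌊d g⌋ ⌊d f⌋ ⋄[y A] ⌊gV g f⌋ = ⌊d (g ∘ f)⌋.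
Proof.
  rewrite <- d_gamma, <- act_vcomp, gamma_gV by reflexivity.
  apply act_id; reflexivity.
Qed.

Lemma iotaV_iV (A : D) :
  (⌊iotaV U (F A)⌋ ⊗ ⟨y A⟩) ⋄[y A] ⌊iV A⌋ = ⌊d (id1 A)⌋.
Proof.
  rewrite <- d_iota, <- act_vcomp, iota_iV by reflexivity.
  apply act_id; reflexivity.
Qed.

(** On transposes, one side is the pasting of [phi], [d (y B)] and [d f] with the first two
    contracted by [Psi B], hence [d f]; on the other side [d f] can be pulled out on top,
    and the rest vanishes by [counit_collapse]. *)
Lemma Psi_modification :
  is_modification (eps_F_eta (F := PF) (counit (@e)) eta) (trans_id F) Psi.
Proof.
  intros A B f.
  change (assocV (eps (F B)) (m1 F (y B)) (m1 F f) ;;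
     (eps (F B) ◁ (gV (y B) f ;; m2 FS (d f) ;; gamma FS (m1 U (m1 F f)) (y A))) ;;
     assoc (eps (F B)) (m1 F (m1 U (m1 F f))) (m1 F (y A)) ;;
     (e (m1 F f) ▷ m1 F (y A)) ;; assocV (m1 F f) (eps (F A)) (m1 F (y A)) ;;
     (m1 F f ◁ Psi A) =
    (Psi B ▷ m1 F f) ;; (lunit (m1 F f) ;; runitV (m1 F f))).
  apply coherent_inj_comp; unfold assoc, assocV, lunit, runitV.
  rewrite !float_vcomp, !float_eqc, !float_hcomp.
  rewrite fvcomp_idl, !fvcomp_idr by boundary.
  rewrite !float_vcomp.
  rewrite !act_vcomp by boundary.
  rewrite (paste_postcomp (q := y (U (F B))) (u' := eps (F B))
    (v' := m1 F (m1 U (m1 F f)) ∘ m1 F (y A))) by boundary.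
  rewrite act_id, !act_vcomp, paste_gV, d_m2 by reflexivity.
  rewrite <- (fvcompA (⟨_⟩ ⊗ ⌊d f⌋)), d_gamma.
  rewrite <- (paste_precomp_inner (f := m1 U (m1 F f) ∘ y A)) by boundary.
  rewrite <- 2!(fvcompA ⌊d f⌋), counit_collapse, fvcomp_idr by reflexivity.
  rewrite (paste_assoc (p := y B) (q := y (U (F B)))) by boundary.
  rewrite (paste_postcomp (q := y B) (u' := id1 (F B)) (v' := m1 F f)) by reflexivity.
  rewrite Psi_eq, act_id, paste_unitl; reflexivity.
Qed.

Hypothesis phi_ext : forall B : C, is_Uext (phi B).
Arguments phi_ext B g a : clear implicits.

Lemma colax_adjunction_FS : is_colax_adjunction PF U eta (counit (@e)) Psi phi.
Proof.
  split.
  - apply natural_unit_eqs; exact unitS.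
  - exact colax_nat_counit.
  - exact Psi_modification.
  - apply modification_counit_eqs; exact counit_e.
  - intros A.
    change (swallowtail_eta (F := PF) (eta := eta) (eps := counit (@e)) Psi phi A) with
      (lunitV (y A) ;; (phi (F A) ▷ y A) ;; assocV (m1 U (eps (F A))) (y (U (F A))) (y A)
       ;; (m1 U (eps (F A)) ◁ d (y A)) ;; assoc (m1 U (eps (F A))) (m1 U (m1 F (y A))) (y A)
       ;; ((gammaV U (eps (F A)) (m1 F (y A)) ;; m2 U (Psi A) ;; iota U (F A)) ▷ y A)
       ;; lunit (y A)).
    apply float_inj; unfold lunitV, assocV, assoc, lunit; rewrite !float_vcomp_eqc.
    rewrite !float_vcomp, !float_eqc, !float_hcomp, !float_vcomp.
    rewrite fvcomp_idl, !fvcomp_idr, !fwhisker_r, !fvcompA by boundary.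
    pose proof (Psi_eq A) as E; unfold paste in E.
    change (fmap U ⌊Psi A⌋) with ⌊m2 U (Psi A)⌋ in E.
    rewrite E.
    rewrite <- fwhisker_r, iotaV_iota by reflexivity; apply fhcomp_idl.
  - intros B.
    change (swallowtail_eps (F := PF) (eta := eta) (eps := counit (@e)) Psi phi B) with
      (runitV (eps B)
       ;; (eps B ◁ (iV (U B) ;; m2 FS (phi B) ;; gamma FS (m1 U (eps B)) (y (U B))))
       ;; assoc (eps B) (m1 F (m1 U (eps B))) (m1 F (y (U B)))
       ;; (e (eps B) ▷ m1 F (y (U B)))
       ;; assocV (eps B) (eps (F (U B))) (m1 F (y (U B)))
       ;; (eps B ◁ Psi (U B)) ;; runit (eps B)).
    apply (Uext_inj (phi_ext B)); rewrite act_id by boundary.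
    unfold runitV, assocV, assoc, runit; rewrite !float_vcomp_eqc.
    rewrite !float_vcomp, !float_eqc, !float_hcomp, !float_vcomp.
    rewrite fvcomp_idl, !fvcomp_idr, !act_vcomp by boundary.
    (* Writing [phi B] as its pasting with the unit square on [y (U B)] gives the inverse of
       [iota] something to act on: it turns this unit square into [d 1], on which [F] of
       [phi B] acts by precomposition with [phi B]. *)
    rewrite <- (paste_unitr (U := U) (u := eps B) (p := y (U B)) (x := ⌊phi B⌋)) at 1
      by reflexivity.
    rewrite (paste_postcomp (q := y (U B)) (u' := eps B)
      (v' := m1 F (m1 U (eps B)) ∘ m1 F (y (U B)))) by boundary.
    rewrite act_id, !act_vcomp, iotaV_iV, d_m2 by reflexivity.
    rewrite <- (fvcompA (⟨_⟩ ⊗ ⌊phi B⌋)), d_gamma.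
    rewrite <- (paste_precomp_inner (f := m1 U (eps B) ∘ y (U B))) by boundary.
    rewrite <- 2!(fvcompA ⌊phi B⌋), counit_collapse, fvcomp_idr by reflexivity.
    reflexivity.
Qed.

End Adjunction.

End Laws.
End Data.

Lemma modification_inverse {C D : twocat} {H G : map1 C D} {a b : trans H G}
  {Gam : forall A : C, a A ⇒ b A} {GamV : forall A : C, b A ⇒ a A} :
  is_modification a b Gam -> (forall A : C, is_inverse (Gam A) (GamV A)) ->
  is_modification b a GamV.
Proof.
  intros M I A B f; apply float_inj; rewrite !float_vcomp, !float_hcomp.
  pose proof (f_equal (fun s => ⌊s⌋) (M A B f)) as E; cbv beta in E.
  rewrite !float_vcomp, !float_hcomp in E.
  destruct (I A) as [IA _], (I B) as [_ IB].
  apply (f_equal (fun s => ⌊s⌋)) in IA, IB; rewrite float_vcomp in IA, IB.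
  rewrite <- (fvcomp_idl (f := b B ∘ m1 H f) (x := ⌊tsq b f⌋)) by reflexivity.
  rewrite float_id_comp, <- IB, fwhisker_r by reflexivity.
  rewrite <- (fvcompA (⌊GamV B⌋ ⊗ _)), <- E, <- !fvcompA, <- fwhisker_l, IA by reflexivity.
  now rewrite <- float_id_comp, fvcomp_idr.
Qed.

(** * The theorem *)

Theorem theorem3p3 (C D : twocat) (U : pseudofunctor C D) (F0 : D -> C)
  (y : forall A : D, hom A (U (F0 A))) (cc : coherently_closed y) :
  exists (S : colax_str (ext_map1 cc)) (e : ext_counit_squares cc),
    let F := ColaxData S in
    let eta := ext_unit cc in
    let eps := ext_counit e in
    let Phi := ext_Phi cc in
    is_colax_functor F /\
    is_colax_nat (functor_id D) (functor_comp U F) eta /\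
    is_colax_nat (functor_comp F U) (functor_id C) eps /\
    is_modification (trans_id U) (U_eps_eta eps eta) Phi /\
    (forall (S' : colax_str (ext_map1 cc)) (e' : ext_counit_squares cc),
       is_colax_nat (functor_id D) (functor_comp U (ColaxData S')) eta ->
       is_modification (trans_id U) (U_eps_eta (ext_counit e') eta) Phi ->
       S' = S /\ e' = e) /\
    (unit_axiom y -> composition_axiom cc ->
       exists (pF : is_pseudofunctor F),
       let PF := Pseudofunctor pF in
       exists (Psi : forall A : D, eps_F_eta (F := PF) eps eta A ⇒ trans_id F A),
         is_invertible_modification (eps_F_eta (F := PF) eps eta) (trans_id F) Psi /\
         is_colax_adjunction PF U eta eps Psi Phi).
Proof.
  pose (d := fun (A B : D) (f : hom A B) => dcell cc (y B ∘ f)).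
  pose (phi := ext_Phi cc).
  assert (d_ext : forall (A B : D) (f : hom A B), is_Uext (d A B f))
    by exact (fun A B f => dext_Uext cc (y B ∘ f)).
  assert (phi_ext : forall B : C, is_Uext (phi B))
    by exact (fun B => dext_Uext cc (id1 (U B))).
  assert (coherent : forall (X : D) (Y : C) (f : hom X (U Y)),
    is_Uext (lunitV f ;; paste_ext (phi Y) (d X (U Y) f)))
    by exact (fun X Y f => dext_coherent cc f).
  destruct (exists_colax_str (F := ext_map1 cc) d_ext) as [S HS].
  destruct (exists_counit (F := ext_map1 cc) coherent) as [e He].
  pose proof (colax_functor_FS (F := ext_map1 cc) d_ext HS) as HF.
  exists S, e; cbv zeta; split; [|split; [|split; [|split; [|split]]]].
  - exact HF.
  - apply (natural_unit_eqs (F := ext_map1 cc) d), HS.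
  - exact (colax_nat_counit (F := ext_map1 cc) coherent HS He).
  - apply (modification_counit_eqs (F := ext_map1 cc) d phi), He.
  - intros S' e' HS' He'; split.
    + apply (unit_eqs_unique (F := ext_map1 cc) d_ext HS).
      apply (natural_unit_eqs (F := ext_map1 cc) d), HS'.
    + apply (counit_eqs_unique (F := ext_map1 cc) coherent He).
      apply (modification_counit_eqs (F := ext_map1 cc) d phi), He'.
  - intros unit_ext comp_ext.
    pose proof (pseudofunctor_FS (F := ext_map1 cc) d_ext HS unit_ext comp_ext) as pF.
    exists pF, (Psi (F := ext_map1 cc) coherent).
    pose proof (Psi_modification (F := ext_map1 cc) coherent HS He pF) as M.
    split; [split; [exact M|]|].
    + assert (I : forall A : D, is_inverse (Psi (F := ext_map1 cc) coherent A) (fill (unit_ext A)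
        (lunitV (y A) ;; paste_ext (phi (F0 A)) (d A (U (F0 A)) (y A)))))
        by exact (fun A => Uext_inverse (coherent A (F0 A) (y A)) (unit_ext A)).
      eexists; split; [exact (modification_inverse M I) | exact I].
    + exact (colax_adjunction_FS (F := ext_map1 cc) coherent HS He pF phi_ext).
Qed.
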